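(* Let $k$ be an algebraically closed field, let $n\ge1$, let $P:=[1:0:\cdots:0]\in\mathbb P^{n+1}(k)$, and let $\mathcal X\subset\mathbb P^{n+1}(k)$ be an irreducible quartic hypersurface with defining equation $F(X_0,\ldots,X_{n+1})=\sum_{i=0}^4F_iX_0^{4-i}$, where $F_i\in k[X_1,\ldots,X_{n+1}]_i$ for $i=0,\ldots,4$. Assume that $P\in\mathcal X$ and $\mathcal X$ is smooth at $P$. Then $P$ is an extendable Galois point for $\mathcal X$ if and only if the following holds: (1) if $\mathrm{char}(k)=3$: $F_2=0$ and $F_3=-G^2F_1$ for some nonzero form $G\in k[X_1,\ldots,X_{n+1}]_1$; (2) if $\mathrm{char}(k)\ne3$: $3F_1F_3-F_2^2=0$. In both cases (when $P$ is an extendable Galois point), the Galois group of $k(\mathcal X)/k(\mathbb P^n(k))$ is a cyclic group of order $3$. Assume instead that $P\notin\mathcal X$, so that $F_0\ne0$, and assume $F_0=1$. Then $P$ is an extendable Galois point for $\mathcal X$ if and only if the following holds: (3) if $\mathrm{char}(k)=2$: $F_1=0$, and there exist nonzero forms $B_1,B_2,B_3\in k[X_1,\ldots,X_{n+1}]$ such that, with $T$ an indeterminate, $$T^3+F_2T+F_3=(T-B_1)(T-B_2)(T-B_3);$$ in this case (when $P$ is an extendable Galois point), the Galois group of $k(\mathcal X)/k(\mathbb P^n(k))$ is the direct product of two cyclic groups of order $2$; (4) if $\mathrm{char}(k)\ne2$: $3F_1^2-8F_2=0$ and $F_1^3-16F_3=0$; in this case (when $P$ is an extendable Galois point), the Galois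 group of $k(\mathcal X)/k(\mathbb P^n(k))$ is a cyclic group of order $4$.
   Context: $k[X_1,\ldots,X_{n+1}]_i$ denotes the space of forms (homogeneous polynomials, including $0$) of degree $i$. An irreducible hypersurface of degree $d$ is one defined by an irreducible form of degree $d$; $k(\mathcal X)$ is its function field. The projection $\pi_P:\mathcal X\dashrightarrow\mathbb P^n(k)$ with center $P=[1:0:\cdots:0]$, $[X_0:\cdots:X_{n+1}]\mapsto[X_1:\cdots:X_{n+1}]$, induces an extension of function fields $k(\mathcal X)/k(\mathbb P^n(k))$. $P$ is a Galois point for $\mathcal X$ if this extension is Galois (inner if $P\in\mathcal X$, outer if $P\notin\mathcal X$). A Galois point $P$ is extendable if every element of the Galois group is induced by an element of $\mathrm{PGL}(n+2,k)$ preserving $\mathcal X$. *)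

(* Defs.v *)
From HB Require Import structures.
From mathcomp Require Import all_boot all_order all_algebra all_fingroup all_field.
From mathcomp Require Import ring_quotient fraction.
From mathcomp Require Import mpoly.
From mathcomp Require Import boolp.
From mathcomp Require Import zify ring.

Set Implicit Arguments.
Unset Strict Implicit.
Unset Printing Implicit Defensive.
Import GRing.Theory.
Local Open Scope ring_scope.

(* The rings {mpoly k[n]} are factorial (by Gauss's lemma), so that an irreducible
   form generates a prime ideal and a hypersurface has a function field. *)

Section Divisibility.
Variable R : idomainType.
Implicit Types a b c p : R.

Definition divides a b := exists c, b = c * a.

Definition irreducible_elt a :=
  a \isn't a GRing.unit /\
  forall b c, a = b * c -> b \is a GRing.unit \/ c \is a GRing.unit.

Definition prime_elt p :=
  [/\ p != 0, p \isn't a GRing.unit &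
      forall a b, divides p (a * b) -> divides p a \/ divides p b].

Definition factors a :=
  exists u (s : seq R), [/\ u \is a GRing.unit,
    (forall p, p \in s -> prime_elt p) & a = u * \prod_(p <- s) p].

Definition factorial_ring := forall a, a != 0 -> factors a.

Lemma divides_mull a b c : divides a c -> divides a (b * c).
Proof. by case=> d ->; exists (b * d); rewrite mulrA. Qed.

Lemma divides_mulr a b c : divides a b -> divides a (b * c).
Proof. by rewrite mulrC; apply: divides_mull. Qed.

Lemma dividesB a b c : divides a b -> divides a c -> divides a (b - c).
Proof. by case=> d -> [e ->]; exists (d - e); rewrite mulrBl. Qed.

Lemma divides0 a : divides a 0.
Proof. by exists 0; rewrite mul0r. Qed.

Lemma prime_ndivides_unit p u :
  prime_elt p -> u \is a GRing.unit -> ~ divides p u.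
Proof.
case=> _ /negP np _ uU [c cu]; apply: np.
by move: uU; rewrite cu unitrM => /andP[].
Qed.

Lemma irreducible_prime a : factorial_ring -> irreducible_elt a -> prime_elt a.
Proof.
move=> fR [na ia].
have a0 : a != 0.
  apply/eqP=> a0; case: (ia 0 0); rewrite ?a0 ?mulr0 ?unitr0 //.
have [u [s [uU ps aE]]] := fR a a0.
case: s ps aE => [|p s] ps aE; first by rewrite aE big_nil mulr1 uU in na.
have pp : prime_elt p by apply: ps; rewrite mem_head.
rewrite big_cons mulrCA in aE.
have [_ np _] := pp.
case: (ia _ _ aE) => [/(negP np) //|wU].
case: pp => p0 _ hp; split=> // b c [d hd].
have {hd} /hp : divides p (b * c).
  by rewrite hd aE; apply: divides_mull; rewrite mulrC; exists (u * \prod_(j <- s) j).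
set w := u * _ in aE wU *.
by case=> -[e ->]; [left|right]; exists (e * w^-1);
  rewrite aE -mulrA [p * w]mulrC mulKr.
Qed.

Lemma prime_divides_prod p u (s : seq R) :
  prime_elt p -> u \is a GRing.unit -> divides p (u * \prod_(q <- s) q) ->
  exists2 q, q \in s & divides p q.
Proof.
move=> pp uU; elim: s => [|q s IH].
  by rewrite big_nil mulr1 => /(prime_ndivides_unit pp uU).
rewrite big_cons mulrCA; case: (pp) => _ _ hp /hp[pq|/IH[r rs pr]].
  by exists q; rewrite // mem_head.
by exists r => //; rewrite inE rs orbT.
Qed.

Lemma prime_divides_prime p q : prime_elt p -> prime_elt q -> divides p q ->
  exists2 t, t \is a GRing.unit & q = t * p.
Proof.
move=> [p0 np hp] [q0 nq hq] [v qv].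
have : divides q (v * p) by rewrite -qv; exists 1; rewrite mul1r.
case/hq=> -[w wE]; last first.
  exists v => //; apply/unitrPr; exists w; apply: (mulIf q0).
  by rewrite mul1r {2}qv wE; ring.
case/negP: np; apply/unitrPr; exists w.
have v0 : v != 0 by apply: contraNneq q0 => v0; rewrite qv v0 mul0r.
by apply: (mulfI v0); rewrite mulr1 {2}wE qv; ring.
Qed.

End Divisibility.

Section Gauss.
Variable R : idomainType.
Implicit Types (p c : R) (f g h : {poly R}).

Lemma prime_polyC p : prime_elt p -> prime_elt (p%:P : {poly R}).
Proof.
move=> [p0 np hp]; split; first by rewrite polyC_eq0.
  by rewrite poly_unitE size_polyC p0 coefC eqxx.
move=> f g; have [n] := ubnP (size f + size g)%N.
elim: n f g => // n IH f g lt_n pfg.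
have [->|f0] := eqVneq f 0; first by left; apply: divides0.
have [->|g0] := eqVneq g 0; first by right; apply: divides0.
have lc : divides p (lead_coef f * lead_coef g).
  by case: pfg => c cE; exists (lead_coef c); rewrite -lead_coefM cE lead_coefM lead_coefC.
have drop h : h != 0 -> divides p (lead_coef h) -> exists h1,
    [/\ (size h1 < size h)%N, divides p%:P (h - h1) &
        (divides p%:P h1 -> divides p%:P h)].
  move=> h0 [c cE]; pose m := c%:P * 'X^((size h).-1) * p%:P.
  have pm : divides p%:P m by exists (c%:P * 'X^((size h).-1)).
  exists (h - m); split; last 1 first.
  - by case=> e eE; case: pm => d dE; exists (e + d); rewrite mulrDl -eE -dE subrK.
  - have mE : m = (lead_coef h) *: 'X^((size h).-1).
      by rewrite /m -mul_polyC cE polyCM; ring.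
    rewrite mE; have sp : (0 < size h)%N by rewrite size_poly_gt0.
    rewrite -(prednK sp) ltnS; apply/leq_sizeP => j hj.
    rewrite coefB coefZ coefXn; case: eqP => [->|/eqP jn].
      by rewrite mulr1 lead_coefE subrr.
    rewrite mulr0 subr0 nth_default // -(prednK sp).
    by rewrite ltn_neqAle eq_sym jn.
  - by rewrite opprB addrC subrK.
case: (hp _ _ lc) => /drop.
- case/(_ f0)=> f1 [sf pm imp].
  case: (IH f1 g) => [| |/imp|]; [|  | by left | by right].
    by rewrite -ltnS (leq_trans _ lt_n) // ltnS ltn_add2r.
  have -> : f1 * g = f * g - (f - f1) * g by ring.
  by apply: dividesB => //; apply: divides_mulr.
- case/(_ g0)=> g1 [sg pm imp].
  case: (IH f g1) => [| | |/imp]; [|  | by left | by right].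
    by rewrite -ltnS (leq_trans _ lt_n) // ltnS ltn_add2l.
  have -> : f * g1 = f * g - f * (g - g1) by ring.
  by apply: dividesB => //; apply: divides_mull.
Qed.

Definition primitive f := forall p, prime_elt p -> ~ divides p%:P f.

Hypothesis fR : factorial_ring R.

Lemma primitive_cancel c f g h : c != 0 -> primitive g ->
  c%:P * f = g * h -> divides g f.
Proof.
move=> /fR[u [s [uU ps ->]]] pg.
elim: s ps h => [|p s IH] ps h.
  rewrite big_nil mulr1 => E; exists (u^-1%:P * h).
  by rewrite -mulrA [h * g]mulrC -E mulrA -polyCM mulVr // mul1r.
have pp : prime_elt p by apply: ps; rewrite mem_head.
rewrite big_cons mulrCA polyCM -mulrA => E.
have : divides p%:P (g * h) by rewrite -E; apply: divides_mulr; exists 1; rewrite mul1r.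
case: (prime_polyC pp) => p0 _ hp /hp[/(pg _ pp) //|[e hE]].
apply: (IH _ e) => [q qs|]; first by apply: ps; rewrite inE qs orbT.
by apply: (mulfI p0); rewrite E hE; ring.
Qed.

Lemma primitive_part f : f != 0 ->
  exists c g, [/\ c != 0, primitive g & f = c%:P * g].
Proof.
move=> f0; have [u [s [uU ps]]] : factors (lead_coef f) by apply: fR; rewrite lead_coef_eq0.
have [n] := ubnP (size s); elim: n u s uU ps f f0 => // n IH u s uU ps f f0 lt_s E.
have [pf|] := pselect (primitive f).
  by exists 1, f; rewrite oner_neq0 mul1r.
move=> /existsNP[p /not_implyP[pp /contrapT[e fE]]].
have e0 : e != 0 by apply: contraNneq f0 => e0; rewrite fE e0 mul0r.
have lE : lead_coef f = lead_coef e * p by rewrite fE lead_coefM lead_coefC.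
have [|q qs pq] := @prime_divides_prod _ p u s pp uU.
  by exists (lead_coef e); rewrite -E.
have [t tU qE] := prime_divides_prime pp (ps _ qs) pq.
have [p0 _ _] := pp.
case: (IH (u * t) (rem q s) _ _ e e0).
- by rewrite unitrM uU.
- by move=> r /mem_rem; apply: ps.
- by rewrite size_rem // -ltnS (leq_trans _ lt_s) // ltnS prednK //; case: (s) qs.
- apply: (mulIf p0); rewrite -lE E (perm_big _ (perm_to_rem qs)) big_cons /= qE; ring.
move=> c [g [c0 pg eE]]; exists (c * p), g; split=> //.
  by rewrite mulf_neq0.
by rewrite fE eE polyCM; ring.
Qed.

Lemma factorsM (S : idomainType) (a b : S) : factors a -> factors b -> factors (a * b).
Proof.
move=> [u [s [uU ps ->]]] [v [t [vU pt ->]]].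
exists (u * v), (s ++ t); split; first by rewrite unitrM uU.
  by move=> p; rewrite mem_cat => /orP[/ps|/pt].
by rewrite big_cat /=; ring.
Qed.

Lemma factors_polyC c : c != 0 -> factors (c%:P : {poly R}).
Proof.
move=> /fR[u [s [uU ps ->]]]; exists u%:P, (map polyC s); split.
- by rewrite rmorph_unit.
- by move=> _ /mapP[p /ps pp ->]; apply: prime_polyC.
- by rewrite polyCM rmorph_prod /= big_map.
Qed.

Lemma factorial_poly : factorial_ring {poly R}.
Proof.
move=> f; have [n] := ubnP (size f); elim: n f => // n IH f lt_n f0.
have [c [g [c0 pg fE]]] := primitive_part f0.
rewrite fE; apply: factorsM; first exact: factors_polyC.
have g0 : g != 0 by apply: contraNneq f0 => g0; rewrite fE g0 mulr0.
have sfg : size f = size g by rewrite fE mul_polyC size_scale.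
have [sg|sg] := leqP (size g) 1.
  by rewrite (size1_polyC sg); apply: factors_polyC; rewrite -polyC_eq0 -size1_polyC.
have [ig|] := pselect (irreducible_poly g).
  exists 1, [:: g]; split; rewrite ?unitr1 // ?big_seq1 ?mul1r //.
  move=> _ /[!inE] /eqP ->; split=> //.
    by rewrite poly_unitE; case: eqP sg => // ->.
  move=> a b [q abE].
  have : g %| a * b by rewrite abE dvdp_mull.
  have back d : g %| d -> divides g d.
    case/Pdiv.Idomain.dvdpP=> -[x y] /= x0; rewrite -mul_polyC [y * g]mulrC.
    exact: primitive_cancel.
  have [ga|nga] := boolP (g %| a); first by left; apply: back.
  by rewrite Gauss_dvdpr ?irreducible_poly_coprime // => /back; right.
move=> nig; have [q [sq qg nqg]] : exists q : {poly R}, [/\ size q != 1%N, q %| g & ~~ (q %= g)].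
  apply: contrapT => nq; apply: nig; split=> // q sq qg.
  by apply/negPn/negP => nqg; apply: nq; exists q.
have q0 : q != 0 by apply: contraTneq qg => ->; rewrite dvd0p.
have [d [q' [d0 pq' qE]]] := primitive_part q0.
have sqq' : size q = size q' by rewrite qE mul_polyC size_scale.
case/Pdiv.Idomain.dvdpP: (qg) => -[x y] /= x0; rewrite -mul_polyC qE => E.
have [h hE] : divides q' g.
  by apply: (@primitive_cancel x _ _ (y * d%:P)) => //; rewrite E; ring.
have q'0 : q' != 0 by rewrite -size_poly_gt0 -sqq' size_poly_gt0.
have h0 : h != 0 by apply: contraNneq g0 => h0; rewrite hE h0 mul0r.
have sE : size g = (size h + size q').-1 by rewrite hE size_mul.
have sq'1 : (1 < size q')%N by rewrite -sqq' ltn_neqAle eq_sym sq size_poly_gt0.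
have lqg : (size q < size g)%N.
  rewrite ltn_neqAle (dvdp_leq g0 qg) andbT.
  by apply: contra nqg; rewrite -dvdp_size_eqp.
have sh1 : (1 < size h)%N.
  by lia.
by rewrite hE; apply: factorsM; apply: IH => //; lia.
Qed.

End Gauss.

Lemma factorial_field (k : fieldType) : factorial_ring k.
Proof.
by move=> a a0; exists a, [::]; split; rewrite ?unitfE ?big_nil ?mulr1.
Qed.

Lemma factorial_iso (R S : idomainType) (f : {rmorphism R -> S}) (g : {rmorphism S -> R}) :
  cancel f g -> cancel g f -> factorial_ring S -> factorial_ring R.
Proof.
move=> fK gK fS a a0.
have dvd x y : divides x y <-> divides (f x) (f y).
  split=> -[c E]; first by exists (f c); rewrite E rmorphM.
  by exists (g c); apply: (can_inj fK); rewrite rmorphM gK.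
have /fS[u [s [uU ps E]]] : f a != 0 by rewrite -(rmorph0 f) (inj_eq (can_inj fK)).
have unitE x : (f x \is a GRing.unit) = (x \is a GRing.unit).
  by apply/idP/idP => [/(rmorph_unit g)|/(rmorph_unit f)] //; rewrite fK.
exists (g u), (map g s); split; first exact: rmorph_unit.
  move=> _ /mapP[p /ps[p0 np hp] ->]; split.
  - by rewrite -(rmorph0 g) (inj_eq (can_inj gK)).
  - by rewrite -unitE gK.
  - by move=> x y /dvd; rewrite rmorphM gK => /hp[] h; [left|right]; apply/dvd; rewrite gK.
by rewrite big_map -rmorph_prod -rmorphM -E fK.
Qed.

Section MpolyFactorial.
Variable R : idomainType.

Lemma mpoly_factorial_succ n :
  factorial_ring {poly {mpoly R[n]}} -> factorial_ring {mpoly R[n.+1]}.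
Proof.
pose f : {rmorphism {mpoly R[n.+1]} -> {poly {mpoly R[n]}}} := @muni n R.
pose g : {rmorphism {poly {mpoly R[n]}} -> {mpoly R[n.+1]}} :=
  horner_eval 'X_ord_max \o @mpwiden n R.
have fX (m : 'X_{1.. n.+1}) : f 'X_[m] =
    ('X_[[multinom (m (widen_ord (leqnSn n) i)) | i < n]])%:P * 'X^(m ord_max).
  by rewrite /f /= muniE msuppX big_seq1 mcoeffX eqxx scale1r mul_polyC.
have gC p : g p%:P = mwiden p by rewrite /g /= /mpwiden map_polyC horner_evalE hornerC.
have gX : g 'X = 'X_ord_max by rewrite /g /= mpwidenX horner_evalE hornerX.
have fZ c p : f (c *: p) = (c%:MP)%:P * f p.
    by rewrite -mul_mpolyC (rmorphM f) /= muniC.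
  have fK : cancel f g.
  move=> p; suff E : g (f (\sum_(m <- msupp p) p@_m *: 'X_[m])) =
      \sum_(m <- msupp p) p@_m *: 'X_[m] by rewrite -mpolyE in E.
  rewrite (rmorph_sum f) (rmorph_sum g); apply: eq_bigr => m _.
  rewrite fZ fX !(rmorphM g) !gC mwidenC (rmorphXn g) gX mul_mpolyC.
  rewrite mwidenX mpolyXn -mpolyXD.
  congr (_ *: 'X_[_]); apply/mnmP=> i; rewrite mnmDE mulmnE mnm1E.
  have [->|] := eqVneq i ord_max.
    by rewrite mnmwiden_ordmax mul1n.
  move=> ni; rewrite mul0n addn0.
  have lt_i : (i < n)%N by move: ni (ltn_ord i); rewrite -val_eqE /= ltnS leq_eqVlt => /negPf->.
  have -> : i = widen_ord (leqnSn n) (Ordinal lt_i) by apply: val_inj.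
  by rewrite mnmwiden_widen mnmE.
have fW p : f (mwiden p) = p%:P.
  rewrite [p]mpolyE (rmorph_sum (@mwiden n R)) (rmorph_sum f) (rmorph_sum (@polyC _)).
  apply: eq_bigr => m _; rewrite -[X in f X]/(mwiden _) mwidenZ fZ mwidenX fX mnmwiden_ordmax.
  rewrite expr0 mulr1 -mul_mpolyC (rmorphM (@polyC {mpoly R[n]})); congr (_ * ('X_[_])%:P).
  by apply/mnmP=> i; rewrite mnmE mnmwiden_widen.
have fM : f 'X_ord_max = 'X.
  rewrite fX mnm1E eqxx expr1.
  suff -> : [multinom U_(ord_max)%MM (widen_ord (leqnSn n) i) | i < n] = 0%MM.
    by rewrite mpolyX0 mul1r.
  by apply/mnmP=> i; rewrite mnmE mnm1E mnm0E; case: eqP => // /(congr1 val) /= E;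
    have := ltn_ord i; rewrite -E ltnn.
have gK : cancel g f.
  apply: poly_ind => [|q c IH]; first by rewrite !rmorph0.
  by rewrite rmorphD rmorphM gX gC rmorphD rmorphM IH fM fW.
exact: (factorial_iso fK gK).
Qed.

End MpolyFactorial.

Lemma factorial_mpoly (k : fieldType) n : factorial_ring {mpoly k[n]}.
Proof.
elim: n => [|n IH]; last exact/mpoly_factorial_succ/factorial_poly.
have fK : cancel (mcoeff 0 : {mpoly k[0]} -> k) (@mpolyC 0 k).
  by move=> p; rewrite -nvar0_mpolyC.
have gK : cancel (@mpolyC 0 k) (mcoeff 0) by move=> c; rewrite mcoeffC eqxx mulr1.
exact: (factorial_iso fK gK (@factorial_field k)).
Qed.

Section Subfield.
Variables (M : fieldType) (S : divringClosed M).

Definition subfield := {z | z \in S}.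
HB.instance Definition _ := SubChoice.on subfield.
HB.instance Definition _ := [SubChoice_isSubIntegralDomain of subfield by <:].
HB.instance Definition _ := [SubIntegralDomain_isSubField of subfield by <:].

End Subfield.

Section Hypersurface.
Variables (k : fieldType) (m : nat).

(* An irreducible hypersurface of the projective space with m homogeneous
   coordinates. *)
Record hypersurface := Hypersurface {
  defining_form : {mpoly k[m]};
  form_homog : defining_form \is homog mdeg;
  form_irreducible : irreducible_elt defining_form
}.

Variable X : hypersurface.

(* The ideal is made decidable classically, as ring quotients require. *)
Definition form_ideal : {pred {mpoly k[m]}} := fun p => `[< divides (defining_form X) p >].

Lemma form_idealP p : reflect (divides (defining_form X) p) (p \in form_ideal).
Proof. exact: asboolP. Qed.

Lemma form_ideal_closed : idealr_closed form_ideal.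
Proof.
split; first by apply/form_idealP/divides0.
  apply/form_idealP => -[c E]; case: (form_irreducible X) => /negP + _; apply.
  by apply/unitrPr; exists c; rewrite mulrC.
move=> a u v /form_idealP[b ->] /form_idealP[c ->].
by apply/form_idealP; exists (a * b + c); rewrite mulrDl mulrA.
Qed.

HB.instance Definition _ := isIdealr.Build {mpoly k[m]} form_ideal form_ideal_closed.

Lemma form_ideal_prime : prime_idealr_closed form_ideal.
Proof.
move=> u v /form_idealP uv; apply/orP.
have [_ _ h] := irreducible_prime (@factorial_mpoly k m) (form_irreducible X).
by case: (h _ _ uv) => ?; [left|right]; apply/form_idealP.
Qed.

HB.instance Definition _ :=
  isPrimeIdealrClosed.Build {mpoly k[m]} form_ideal form_ideal_prime.

Definition coord_ring := {ideal_quot form_ideal}.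
HB.instance Definition _ := GRing.ComNzRing.on coord_ring.

Definition coord_unit : {pred coord_ring} := fun x => `[< exists y, y * x = 1 >].
Definition coord_inv (x : coord_ring) : coord_ring :=
  if pselect (exists y, y * x = 1) is left xU then projT1 (cid xU) else x.

Lemma coord_mulVr : {in coord_unit, left_inverse 1 coord_inv *%R}.
Proof.
move=> x /asboolP xU; rewrite /coord_inv; case: pselect => // yU.
exact: (projT2 (cid yU)).
Qed.

Lemma coord_unitP x y : y * x = 1 -> coord_unit x.
Proof. by move=> yx; apply/asboolP; exists y. Qed.

Lemma coord_inv_out : {in [predC coord_unit], coord_inv =1 id}.
Proof.
move=> x /negP xU; rewrite /coord_inv; case: pselect => // yU.
by case: xU; apply/asboolP.
Qed.

HB.instance Definition _ := GRing.ComNzRing_hasMulInverse.Build coord_ring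
  coord_mulVr coord_unitP coord_inv_out.

Lemma coord_ring_idomain : GRing.integral_domain_axiom coord_ring.
Proof. by move=> x y; apply: (@Quotient.rquot_IdomainAxiom _ form_ideal). Qed.

HB.instance Definition _ :=
  GRing.ComUnitRing_isIntegral.Build coord_ring coord_ring_idomain.

Definition coord (p : {mpoly k[m]}) : {fraction coord_ring} :=
  FracField.tofrac ((\pi p)%qT : coord_ring).

Lemma coord_is_zmod_morphism : zmod_morphism coord.
Proof.
move=> p q; rewrite /coord -rmorphB; congr FracField.tofrac.
by rewrite !piE.
Qed.

Lemma coord_is_monoid_morphism : monoid_morphism coord.
Proof.
split=> [|p q]; rewrite /coord -?rmorphM -?(rmorph1 (@FracField.tofrac _)).
  by congr FracField.tofrac; rewrite !piE.
by congr FracField.tofrac; rewrite !piE.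
Qed.

HB.instance Definition _ := GRing.isZmodMorphism.Build {mpoly k[m]}
  {fraction coord_ring} coord coord_is_zmod_morphism.
HB.instance Definition _ := GRing.isMonoidMorphism.Build {mpoly k[m]}
  {fraction coord_ring} coord coord_is_monoid_morphism.

Lemma coord_eq0 p : coord p = 0 <-> divides (defining_form X) p.
Proof.
rewrite /coord -(rmorph0 (@FracField.tofrac _)); split.
  move=> /eqP; rewrite tofrac_eq => /eqP.
  have -> : (0 : coord_ring) = (\pi 0)%qT by rewrite !piE.
  move=> /eqP; rewrite piE Quotient.equivE subr0 => /form_idealP //.
move=> /form_idealP pI; congr FracField.tofrac.
have -> : (0 : coord_ring) = (\pi 0)%qT by rewrite !piE.
by apply/eqP; rewrite piE Quotient.equivE subr0.
Qed.

(* The function field of the hypersurface consists of the quotients of forms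
   of the same degree. *)
Definition rational_function : {pred {fraction coord_ring}} := fun z =>
  `[< exists d f g, [/\ f \is d.-homog, g \is d.-homog, ~ divides (defining_form X) g
        & z = coord f / coord g] >].

Lemma rational_function_divring : divring_closed rational_function.
Proof.
have ndM g h : ~ divides (defining_form X) g -> ~ divides (defining_form X) h ->
    ~ divides (defining_form X) (g * h).
  move=> ng nh; rewrite -coord_eq0 rmorphM => /eqP; rewrite mulf_eq0.
  by case/orP=> /eqP/coord_eq0.
have nz g : ~ divides (defining_form X) g -> coord g != 0 by move=> ng; apply/eqP => /coord_eq0.
split.
- apply/asboolP; exists 0%N, 1, 1; split; rewrite ?dhomog1 ?rmorph1 ?divr1 //.
  by rewrite -coord_eq0 rmorph1 => /eqP; rewrite oner_eq0.
- move=> _ _ /asboolP[d [f [g [hf hg ng ->]]]] /asboolP[e [f' [g' [hf' hg' ng' ->]]]].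
  apply/asboolP; exists (d + e)%N, (f * g' - f' * g), (g * g'); split.
  + by apply: rpredB; [|rewrite addnC]; apply: dhomogM.
  + exact: dhomogM.
  + exact: ndM.
  + by rewrite -mulNr addf_div ?nz // mulNr rmorphB !rmorphM.
- move=> _ _ /asboolP[d [f [g [hf hg ng ->]]]] /asboolP[e [f' [g' [hf' hg' ng' ->]]]].
  have [/coord_eq0 E|nf'] := pselect (divides (defining_form X) f').
    rewrite E mul0r invr0 mulr0; apply/asboolP; exists d, 0, g.
    by split; rewrite ?dhomog0 ?rmorph0 ?mul0r.
  apply/asboolP; exists (d + e)%N, (f * g'), (g * f'); split.
  + exact: dhomogM.
  + exact: dhomogM.
  + exact: ndM.
  + by rewrite invf_div mulf_div !rmorphM.
Qed.

HB.instance Definition _ := GRing.isDivringClosed.Build {fraction coord_ring}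
  rational_function rational_function_divring.

Definition function_field : fieldType := subfield rational_function.

End Hypersurface.

Section FieldExtension.
Variables (L : fieldType) (K : {pred L}).

Definition algebraic_ext := forall x : L,
  exists p : {poly L}, [/\ p != 0, p \is a polyOver K & root p x].

Definition minimal_polynomial (x : L) (p : {poly L}) :=
  [/\ p \is monic, p \is a polyOver K, root p x
    & forall q, q \is a polyOver K -> root q x -> p %| q].

Definition separable_ext :=
  forall x p, minimal_polynomial x p -> separable_poly p.

Definition normal_ext := forall x p, minimal_polynomial x p ->
  exists rs : seq L, p = \prod_(r <- rs) ('X - r%:P).

Definition galois_ext := [/\ algebraic_ext, separable_ext & normal_ext].

Definition galois_aut (s : {rmorphism L -> L}) := bijective s /\ {in K, s =1 id}.

Definition galois_group_isom (gT : finGroupType) :=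
  exists f : gT -> {rmorphism L -> L},
    [/\ forall a, galois_aut (f a),
        forall a b, f (a * b)%g =1 f a \o f b,
        forall a b, f a =1 f b -> a = b
      & forall s, galois_aut s -> exists a, s =1 f a].

End FieldExtension.

Section Points.
Variables (k : fieldType) (m : nat) (X : hypersurface k m).

Definition on_hypersurface (v : 'cV[k]_m) := (defining_form X).@[fun i => v i 0] = 0.

Definition smooth_at (v : 'cV[k]_m) :=
  exists i, (defining_form X)^`M(i).@[fun j => v j 0] != 0.

Definition preserves (A : 'M[k]_m) :=
  forall v, on_hypersurface (A *m v) <-> on_hypersurface v.

(* (pullback A p)(v) = p(A v) *)
Definition pullback (A : 'M[k]_m) (p : {mpoly k[m]}) : {mpoly k[m]} :=
  p \mPo [tuple \sum_j A i j *: 'X_j | i < m].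

Definition induces (A : 'M[k]_m) (s : function_field X -> function_field X) :=
  forall z d f g, f \is d.-homog -> g \is d.-homog -> ~ divides (defining_form X) g ->
    \val z = coord X f / coord X g ->
    ~ divides (defining_form X) (pullback A g) /\
    \val (s z) = coord X (pullback A f) / coord X (pullback A g).

End Points.

(* The coordinates of P^(n+1) are 'X_0, ..., 'X_(n+1); those of the target P^n
   of the projection from [1 : 0 : ... : 0] are 'X_1, ..., 'X_(n+1), so that
   'X_j in {mpoly k[n.+1]} stands for 'X_(j+1) in {mpoly k[n.+2]}. *)
Definition lift_form (k : fieldType) n (p : {mpoly k[n.+1]}) : {mpoly k[n.+2]} :=
  p \mPo [tuple 'X_(lift ord0 j) | j < n.+1].

Section Projection.
Variables (k : fieldType) (n : nat) (X : hypersurface k n.+2).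

Definition proj_center : 'cV[k]_n.+2 := delta_mx ord0 0.

(* k(P^n), as embedded in k(X) by the projection from the center; this is the
   pullback of all of k(P^n) as soon as the projection is dominant. *)
Definition projection_field : {pred function_field X} := fun z =>
  `[< exists d (f g : {mpoly k[n.+1]}), [/\ f \is d.-homog, g \is d.-homog,
        ~ divides (defining_form X) (lift_form g)
      & \val z = coord X (lift_form f) / coord X (lift_form g)] >].

Definition galois_point := galois_ext projection_field.

(* The elements of PGL(n+2, k) are represented by invertible matrices. *)
Definition extendable_galois_point := galois_point /\
  forall s, galois_aut projection_field s ->
    exists A, [/\ A \in unitmx, preserves X A & induces A s].

End Projection.

Arguments projection_field {k n} X _.

(* Main.v *)
Require Import Defs.
From HB Require Import structures.
From mathcomp Require Import all_boot all_order all_algebra.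
From mathcomp Require Import all_fingroup all_solvable all_field.
From mathcomp Require Import ring_quotient fraction.
From mathcomp Require Import mpoly boolp zify ring.

(** Write the equation of the hypersurface as [f(X_0) = 0], with [f] a polynomial
in [X_0] whose coefficients are forms in the other coordinates.  With
[t = X_0 / X_1], the function field [L] of the hypersurface is [K(t)], where [K]
is the function field of the target of the projection, and [f], with its
coefficients divided by powers of [X_1], is up to a scalar the minimal polynomial
of [t] over [K]: a relation of lower degree in [t] would, once its denominators
are cleared, be a multiple of [f] of lower degree in [X_0].

An automorphism of [L] over [K] is determined by the image of [t], and every root
of [f] in [L] is such an image.  Hence the center is a Galois point exactly when
[f] splits in [L] with distinct roots, and then the Galois group is in bijection
with the roots ([root_family_galois], [galois_split]).

The core of the proof is that extendable automorphisms are affine in [X_0].  A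
matrix that induces an automorphism over [K] preserves all the ratios
[X_i / X_1] with [i > 0]; both sides of the resulting identity between quadratic
forms differ by a multiple of the equation, which has degree 4, so they are
equal, and the matrix multiplies [X_1], ..., [X_(n+1)] by a common scalar (two of
them are needed here, which is where [n >= 1] enters).  The automorphism is thus
[t |-> a t + p] with [a] a nonzero constant and [p] a linear form.  Since
[a X_0 + p] is again a root, [f(a X_0 + p) = a^d f(X_0)], with [d] the degree of
[f] in [X_0].  So the center is an extendable Galois point exactly when [f] has
[d] affine symmetries ([extendable_affine_maps], [affine_family_extendable]).

It remains to solve [f(a X_0 + p) = a^d f(X_0)] by comparing coefficients.  If
[a <> 1], the symmetry is the homothety of ratio [a] about [- m], where
[m = p / (a - 1)].  In the variable [X_0 + m] the coefficient of [X_0^(d-1)]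
vanishes, and the constant coefficient does not since [f] is irreducible;
therefore [a^d = 1].  If [a = 1], the symmetry is a translation.

- For [d = 3] a homothety exists only if [f = F_1 (X_0 + m)^3 + H], which says
  [3 F_1 F_3 = F_2^2] and requires 3 to be invertible; a nonzero translation
  exists only in characteristic 3, and says that [F_2 = 0] and that [p] is a root
  of [F_1 T^2 + F_3].
- For [d = 4] and 2 invertible there are no translations but the identity, and
  four symmetries force [f = (X_0 + m)^4 + H].  In characteristic 2 the
  symmetries are all translations, by 0 and by the roots of [T^3 + F_2 T + F_3].

Conversely these equations have cyclic groups of homotheties, or groups of
translations of order 3 and type (2, 2), as symmetries. *)

Set Implicit Arguments.
Unset Strict Implicit.
Unset Printing Implicit Defensive.
Import GRing.Theory.
Local Open Scope ring_scope.

(** * Simple extensions: conjugates, automorphisms and the Galois property *)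

Lemma rmorphism_from (A B : nzRingType) (g : A -> B) :
  zmod_morphism g -> monoid_morphism g -> exists s : {rmorphism A -> B}, s =1 g.
Proof.
move=> gB gM.
pose mB := GRing.isZmodMorphism.Build A B g gB.
pose mM := GRing.isMonoidMorphism.Build A B g gM.
pose s : {rmorphism A -> B} := HB.pack g mB mM.
by exists s.
Qed.

Section SimpleExtension.
Variables (L : fieldType) (K : divringClosed L) (t : L) (P : {poly L}).
Implicit Types (p q : {poly L}) (s : {rmorphism L -> L}).
Local Notation E := (subfield K).
Local Notation iota := (val : E -> L).

Lemma polyOver_subfield p : p \is a polyOver K -> exists q : {poly E}, p = map_poly iota q.
Proof.
move=> /polyOverP pK; exists (\poly_(i < size p) (Sub p`_i (pK i) : E)).
apply/polyP=> i; rewrite coef_map coef_poly; case: ltnP => [|le_i] //=.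
by rewrite nth_default.
Qed.

Lemma subfield_polyOver (q : {poly E}) : map_poly iota q \is a polyOver K.
Proof. by apply/polyOverP=> i; rewrite coef_map /=; apply: (valP q`_i). Qed.

(** The Euclidean operations on polynomials over a subfield stay over the
subfield, because they commute with the inclusion of the subfield. *)
Lemma divp_subfield : {in polyOver K &, forall p q, p %/ q \is a polyOver K}.
Proof.
move=> _ _ /polyOver_subfield[p ->] /polyOver_subfield[q ->].
by rewrite -map_divp subfield_polyOver.
Qed.

Lemma modp_subfield : {in polyOver K &, forall p q, p %% q \is a polyOver K}.
Proof.
move=> _ _ /polyOver_subfield[p ->] /polyOver_subfield[q ->].
by rewrite -map_modp subfield_polyOver.
Qed.

Lemma gcdp_subfield : {in polyOver K &, forall p q, gcdp p q \is a polyOver K}.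
Proof.
move=> _ _ /polyOver_subfield[p ->] /polyOver_subfield[q ->].
by rewrite -gcdp_map subfield_polyOver.
Qed.

Lemma egcdp_subfield : {in polyOver K &, forall p q,
  (egcdp p q).1 \is a polyOver K /\ (egcdp p q).2 \is a polyOver K}.
Proof.
move=> _ _ /polyOver_subfield[p ->] /polyOver_subfield[q ->].
by rewrite egcdp_map !subfield_polyOver.
Qed.

Lemma fix_horner s p z : {in K, s =1 id} -> p \is a polyOver K -> s p.[z] = p.[s z].
Proof.
move=> sK /polyOverP pK; rewrite -horner_map; congr (_.[_]).
by apply/polyP=> i; rewrite coef_map; apply: sK.
Qed.

Hypotheses (PK : P \is a polyOver K) (P0 : P != 0) (Pt : root P t).
Hypothesis Pmin : forall q, q \is a polyOver K -> q != 0 -> root q t ->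
  (size P <= size q)%N.
Hypothesis Lgen : forall z, exists a b,
  [/\ a \is a polyOver K, b \is a polyOver K & z = a.[t] / b.[t]].

Lemma min_dvd q : q \is a polyOver K -> root q t -> P %| q.
Proof.
move=> qK qt; apply/modp_eq0P/eqP.
have [//|r0] := eqVneq (q %% P) 0.
have := Pmin (modp_subfield qK PK) r0; rewrite leqNgt ltn_modp P0 /=; apply.
rewrite rootE; move/eqP: qt; rewrite [q in q.[_]](divp_eq q P) hornerD hornerM.
by rewrite (rootP Pt) mulr0 add0r => ->.
Qed.

(** [L] is generated by [t] as a ring: a Bezout relation between [b] and the
minimal polynomial gives the inverse of [b.[t]]. *)
Lemma min_inverse b : b \is a polyOver K -> b.[t] != 0 ->
  exists2 c, c \is a polyOver K & c.[t] = b.[t]^-1.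
Proof.
move=> bK bt; pose g := gcdp P b.
have gK : g \is a polyOver K by apply: gcdp_subfield.
have PE : P = P %/ g * g by rewrite divpK // dvdp_gcdl.
have g0 : g != 0 by apply: contraNneq P0 => g0; rewrite PE g0 mulr0.
have h0 : P %/ g != 0 by apply: contraNneq P0 => h0; rewrite PE h0 mul0r.
have gt : ~~ root g t by apply: contra bt; rewrite -rootE; apply: root_dvdp (dvdp_gcdr _ _).
have sg : size g = 1%N.
  have : root (P %/ g * g) t by rewrite -PE.
  rewrite rootM (negPf gt) orbF => /(Pmin (divp_subfield PK gK) h0).
  rewrite {1}PE size_mul //; move: h0 g0; rewrite -!size_poly_gt0.
  by move: (size (P %/ g)) (size g) => [|u] [|[|v]] // _ _; lia.
have [uK vK] := egcdp_subfield PK bK.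
set u := (egcdp P b).1 in uK; set v := (egcdp P b).2 in vK.
have gE : g %= u * P + v * b := egcdpE P b.
have wt : (u * P + v * b).[t] = v.[t] * b.[t].
  by rewrite hornerD !hornerM (rootP Pt) mulr0 add0r.
have wK : u * P + v * b \is a polyOver K by rewrite rpredD ?rpredM.
have wC : u * P + v * b = (v.[t] * b.[t])%:P.
  have sw : (size (u * P + v * b)%R <= 1)%N by rewrite -(eqp_size gE) sg.
  by rewrite -wt (size1_polyC sw) hornerC.
exists ((v.[t] * b.[t])^-1 *: v).
  by rewrite polyOverZ // rpredV -polyOverC -wC.
have vt : v.[t] != 0.
  by apply: contraNneq gt => vt; rewrite (eqp_root gE) rootE wt vt mul0r.
by rewrite hornerZ invfM mulrAC mulVf // mul1r.
Qed.

Lemma ext_poly z : exists q, q \is a polyOver K /\ z = q.[t].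
Proof.
have [a [b [aK bK ->]]] := Lgen z.
have [b0|b0] := eqVneq b.[t] 0.
  by exists 0; rewrite rpred0 b0 invr0 mulr0 horner0.
have [c cK <-] := min_inverse bK b0.
by exists (a * c); rewrite rpredM ?hornerM.
Qed.

(** The endomorphism is [q.[t] |-> q.[r]]; it is well defined because two
polynomials with the same value at [t] differ by a multiple of [P], which
vanishes at [r]. *)
Lemma root_endo r : root P r -> exists s, {in K, s =1 id} /\ s t = r.
Proof.
move=> Pr.
have key p q : p \is a polyOver K -> q \is a polyOver K -> p.[t] = q.[t] -> p.[r] = q.[r].
  move=> pK qK pq; apply/eqP; rewrite -subr_eq0 -hornerN -hornerD -rootE.
  apply: root_dvdp Pr; apply: min_dvd; first by rewrite rpredB.
  by rewrite rootE hornerD hornerN pq subrr.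
have [g gP] := choice (fun z => ext_poly z).
have gE q : q \is a polyOver K -> (g q.[t]).[r] = q.[r].
  by move=> qK; have [gK gt] := gP q.[t]; apply: key.
have [||s sE] := @rmorphism_from L L (fun z => (g z).[r]).
- move=> x y; have [xK {1}->] := gP x; have [yK {1}->] := gP y.
  by rewrite -hornerN -hornerD gE ?rpredB // hornerD hornerN.
- split=> [|x y]; first by rewrite -{1}(hornerC 1 t) gE ?polyOverC ?rpred1 // hornerC.
  have [xK {1}->] := gP x; have [yK {1}->] := gP y.
  by rewrite -hornerM gE ?rpredM // hornerM.
exists s; split=> [z zK|].
  by rewrite sE -{1}(hornerC z t) gE ?hornerC // polyOverC.
by rewrite sE -{1}(hornerX t) gE ?hornerX // polyOverX.
Qed.

Lemma endo_eq s s' : {in K, s =1 id} -> {in K, s' =1 id} -> s t = s' t -> s =1 s'.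
Proof.
by move=> sK s'K E z; have [q [qK ->]] := ext_poly z; rewrite !fix_horner // E.
Qed.

Lemma endo_root s r : {in K, s =1 id} -> root P r -> root P (s r).
Proof. by move=> sK /eqP Pr; rewrite rootE -fix_horner // Pr rmorph0. Qed.

Section Split.
Variable rs : seq L.
Hypotheses (Urs : uniq rs) (Prs : P = lead_coef P *: \prod_(r <- rs) ('X - r%:P)).

Lemma root_split r : root P r = (r \in rs).
Proof. by rewrite Prs rootZ ?lead_coef_eq0 // root_prod_XsubC. Qed.

Lemma size_split : size P = (size rs).+1.
Proof. by rewrite Prs size_scale ?lead_coef_eq0 // size_prod_XsubC. Qed.

(** Surjectivity comes from counting: the endomorphism permutes the finite set
of the roots of [P], so [t] is in its image. *)
Lemma endo_aut s : {in K, s =1 id} -> galois_aut K s.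
Proof.
move=> sK; split=> //.
have sI : injective s by apply: fmorph_inj.
have /(_ t) trs : map s rs =i rs.
  apply: (uniq_min_size _ _ _).2; rewrite ?size_map ?map_inj_uniq //.
  by move=> _ /mapP[r rR ->]; rewrite -root_split endo_root // root_split.
have /mapP[r _ tE] : t \in map s rs by rewrite trs -root_split.
have surj z : exists y, s y = z.
  have [q [qK ->]] := ext_poly z; exists q.[r].
  by rewrite fix_horner // -tE.
have [g gK] := choice surj; exists g => // y.
by apply: sI; rewrite gK.
Qed.

Lemma root_aut r : r \in rs -> exists2 s, galois_aut K s & s t = r.
Proof.
by rewrite -root_split => /root_endo[s [sK st]]; exists s => //; apply: endo_aut.
Qed.

(** Write the element as [q.[t]] with [q] of lower degree than [P]. If all
automorphisms fix it, then [q] takes the same value at all the roots of [P],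
which are more numerous than its degree allows unless [q] is constant. *)
Lemma fixed_base z : (forall s, galois_aut K s -> s z = z) -> z \in K.
Proof.
have [q0 [q0K ->]] := ext_poly z; pose q := q0 %% P.
have qK : q \is a polyOver K by apply: modp_subfield.
have -> : q0.[t] = q.[t].
  by rewrite [q0 in LHS](divp_eq q0 P) hornerD hornerM (rootP Pt) mulr0 add0r.
move=> fixz; suff qC : q = (q.[t])%:P by rewrite -polyOverC -qC.
apply/eqP; rewrite -subr_eq0; apply: contraT => d0.
have := @max_poly_roots _ _ rs d0 _ Urs.
have -> : all (root (q - q.[t]%:P)) rs.
  apply/allP=> r rR; have [s [sb sK] <-] := root_aut rR.
  by rewrite rootE !hornerE -fix_horner // fixz // subrr.
move=> /(_ isT); rewrite ltnNge (leq_trans (size_polyD _ _)) // geq_max.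
rewrite -ltnS -size_split ltn_modp P0 /= size_polyN (leq_trans (size_polyC_leq1 _)) //.
have : t \in rs by rewrite -root_split.
by case: (rs).
Qed.

(** The conjugates of [x] under the automorphisms form a finite set stable under
them, so the product of the [X - c] over the distinct conjugates [c] has
coefficients in [K], is split and separable, and is a multiple of the minimal
polynomial of [x]. *)
Lemma split_galois : galois_ext K.
Proof.
have trs : t \in rs by rewrite -root_split.
have conj x : exists2 cs, uniq cs &
    x \in cs /\ \prod_(c <- cs) ('X - c%:P) \is a polyOver K.
  have [q [qK ->]] := ext_poly x; pose cs := undup (map (fun r => q.[r]) rs).
  exists cs; first exact: undup_uniq.
  split; first by rewrite mem_undup; apply/mapP; exists t.
  apply/polyOverP=> i; apply: fixed_base => s [sb sK].
  suff E : map_poly s (\prod_(c <- cs) ('X - c%:P)) = \prod_(c <- cs) ('X - c%:P).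
    by rewrite -{2}E coef_map.
  rewrite rmorph_prod; under eq_bigr do rewrite rmorphB /= map_polyX map_polyC /=.
  rewrite -(big_map s xpredT (fun c => 'X - c%:P)); apply: perm_big.
  have sI : injective s by apply: fmorph_inj.
  have Us : uniq (map s cs) by rewrite map_inj_uniq ?undup_uniq.
  apply: uniq_perm; rewrite ?undup_uniq //.
  apply: (uniq_min_size _ _ _).2; rewrite ?size_map //.
  move=> _ /mapP[y + ->]; rewrite !mem_undup => /mapP[r rR ->].
  apply/mapP; exists (s r); last by rewrite fix_horner.
  by rewrite -root_split endo_root // root_split.
split.
- move=> x; have [cs Ucs [xcs csK]] := conj x.
  exists (\prod_(c <- cs) ('X - c%:P)); split=> //; last by rewrite root_prod_XsubC.
  by rewrite monic_neq0 // monic_prod_XsubC.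
- move=> x p [pm pK px pmin]; have [cs Ucs [xcs csK]] := conj x.
  apply: (@dvdp_separable _ (\prod_(c <- cs) ('X - c%:P))).
    by apply: pmin; rewrite ?root_prod_XsubC.
  by rewrite separable_prod_XsubC.
- move=> x p [pm pK px pmin]; have [cs Ucs [xcs csK]] := conj x.
  have /dvdp_prod_XsubC[m mE] : p %| \prod_(c <- cs) ('X - c%:P).
    by apply: pmin; rewrite ?root_prod_XsubC.
  exists (mask m cs); apply/eqP; rewrite -eqp_monic ?monic_prod_XsubC //.
Qed.

End Split.

Lemma galois_split : galois_ext K ->
  exists2 rs, uniq rs & P = lead_coef P *: \prod_(r <- rs) ('X - r%:P).
Proof.
case=> _ sep nor; have l0 : lead_coef P != 0 by rewrite lead_coef_eq0.
pose p := (lead_coef P)^-1 *: P.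
have minp : minimal_polynomial K t p.
  split.
  - by rewrite monicE lead_coefZ mulVf.
  - by apply: polyOverZ => //; rewrite rpredV lead_coefE (polyOverP PK).
  - by rewrite rootZ ?invr_eq0.
  - by move=> q qK qt; rewrite dvdpZl ?invr_eq0 // min_dvd.
have [rs pE] := nor _ _ minp; exists rs; last by rewrite -pE scalerA mulfV ?scale1r.
by rewrite -separable_prod_XsubC -pE; apply: sep minp.
Qed.

(** Indexing the roots of [P] by a group, compatibly with the action of the
automorphisms on the roots, presents the Galois group as that group. *)
Lemma root_family_galois (gT : finGroupType) (rho : gT -> L) :
    injective rho -> (forall a, root P (rho a)) -> size P = #|gT|.+1 ->
    (forall s a b, galois_aut K s -> s t = rho a -> s (rho b) = rho (a * b)%g) ->
  [/\ galois_ext K, galois_group_isom K gT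
    & forall s, galois_aut K s -> exists a, s t = rho a].
Proof.
move=> rhoI rhoP szP rhoM; pose rs := map rho (enum gT).
have Urs : uniq rs by rewrite map_inj_uniq ?enum_uniq.
have Prs : P = lead_coef P *: \prod_(r <- rs) ('X - r%:P).
  apply: all_roots_prod_XsubC; rewrite ?uniq_rootsE //.
    by rewrite szP size_map -cardE.
  by apply/allP=> _ /mapP[a _ ->].
have rsE r : root P r -> exists a, r = rho a.
  by rewrite (root_split Prs) => /mapP[a _ ->]; exists a.
have autE s : galois_aut K s -> exists a, s t = rho a.
  by case=> _ sK; apply: rsE; apply: endo_root.
split=> //; first exact: split_galois Urs Prs.
have ex a : exists s, galois_aut K s /\ s t = rho a.
  have [|s sG st] := root_aut Urs Prs (r := rho a); first by rewrite -(root_split Prs).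
  by exists s.
have [f fP] := choice ex; exists f; split.
- by move=> a; case: (fP a).
- move=> a b; have [[_ abK] abt] := fP (a * b)%g.
  have [faG at_] := fP a; have [[_ bK] bt] := fP b; have [_ aK] := faG.
  apply: (endo_eq (s' := f a \o f b)) => //=.
    by move=> z zK /=; rewrite bK // aK.
  by rewrite bt abt (rhoM _ a).
- move=> a b fab; apply: rhoI; have [_ <-] := fP a; have [_ <-] := fP b; exact: fab.
- move=> s sG; have [a sa] := autE s sG; exists a.
  have [[_ aK] at_] := fP a; have [_ sK] := sG.
  by apply: endo_eq => //; rewrite sa at_.
Qed.

End SimpleExtension.

(** * Forms, and polynomials in the coordinate of the projection *)

Lemma mpoly_rmorph_eq (k : fieldType) n (B : comNzRingType)
    (g h : {rmorphism {mpoly k[n]} -> B}) :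
  (forall c, g c%:MP = h c%:MP) -> (forall i, g 'X_i = h 'X_i) -> g =1 h.
Proof.
move=> eC eX p; rewrite [p]mpolyE !rmorph_sum; apply: eq_bigr => m _.
rewrite -mul_mpolyC !rmorphM eC; congr (_ * _).
by rewrite mpolyXE_id !rmorph_prod; apply: eq_bigr => i _; rewrite !rmorphXn eX.
Qed.

Lemma poly_rmorph_eq (A B : nzRingType) (g h : {rmorphism {poly A} -> B}) :
  (forall c, g c%:P = h c%:P) -> g 'X = h 'X -> g =1 h.
Proof.
move=> eC eX; elim/poly_ind => [|p c IH]; first by rewrite !rmorph0.
by rewrite !rmorphD !rmorphM eC eX IH.
Qed.

Lemma dhomogC (k : fieldType) n (c : k) : c%:MP \is [in k[n], 0.-homog].
Proof. by rewrite -[_%:MP]mulr1 mul_mpolyC rpredZ // dhomog1. Qed.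

Lemma dhomog_comp (k : fieldType) n m (S : n.-tuple {mpoly k[m]}) (p : {mpoly k[n]}) d :
  (forall i, tnth S i \is 1.-homog) -> p \is d.-homog -> p \mPo S \is d.-homog.
Proof.
move=> hS /dhomogP hp; rewrite [p]mpolyE raddf_sum /= big_seq.
apply: rpred_sum => j jp; rewrite comp_mpolyZ rpredZ // comp_mpolyX -(hp _ jp) /= mdegE.
elim/big_rec2: _ => [|i u v _ hv]; first exact: dhomog1.
by apply: dhomogM => //; rewrite -[X in X.-homog]mul1n dhomogMn.
Qed.

Lemma linear_formE (k : fieldType) n (p : {mpoly k[n]}) :
  p \is 1.-homog -> p = \sum_j p@_U_(j) *: 'X_j.
Proof.
move=> hp; apply/mpolyP => m; rewrite raddf_sum /=.
under eq_bigr do rewrite mcoeffZ mcoeffX.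
have [/mdeg1P[i /eqP ->]|m1] := boolP (mdeg m == 1%N).
  rewrite (bigD1 i) //= eqxx mulr1 big1 ?addr0 // => j ji.
  case: eqP => [/mnmP/(_ j)|]; last by rewrite mulr0.
  by rewrite !mnm1E eqxx eq_sym (negPf ji).
rewrite (dhomog_nemf_coeff hp) ?big1 // => j _.
by case: eqP => [jm|_]; rewrite ?mulr0 //; case/eqP: m1; rewrite -jm mdeg1.
Qed.

HB.instance Definition _ (k : fieldType) n :=
  GRing.RMorphism.copy (@lift_form k n) (comp_mpoly [tuple 'X_(lift ord0 j) | j < n.+1]).
HB.instance Definition _ (k : fieldType) m (A : 'M[k]_m) :=
  GRing.RMorphism.copy (pullback A) (comp_mpoly [tuple \sum_j A i j *: 'X_j | i < m]).
Section Forms.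
Variables (k : fieldType) (n : nat).
Implicit Types (p : {mpoly k[n.+1]}) (g : {mpoly k[n.+2]}) (q : {poly {mpoly k[n.+1]}}).

Lemma lift_formC c : lift_form c%:MP = c%:MP :> {mpoly k[n.+2]}.
Proof. exact: comp_mpolyC. Qed.

Lemma lift_formX (j : 'I_n.+1) : lift_form 'X_j = 'X_(lift ord0 j) :> {mpoly k[n.+2]}.
Proof. by rewrite /lift_form comp_mpolyXU -tnth_nth tnth_mktuple. Qed.

Lemma lift_form_homog p d : p \is d.-homog -> lift_form p \is d.-homog.
Proof. by apply: dhomog_comp => i; rewrite tnth_mktuple dhomogX /= mdeg1. Qed.

Lemma pullbackC m (A : 'M[k]_m) c : pullback A c%:MP = c%:MP.
Proof. exact: comp_mpolyC. Qed.

Lemma pullbackX m (A : 'M[k]_m) i : pullback A 'X_i = \sum_j A i j *: 'X_j.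
Proof. by rewrite /pullback comp_mpolyXU -tnth_nth tnth_mktuple. Qed.

Lemma pullback_homog m (A : 'M[k]_m) (g : {mpoly k[m]}) d :
  g \is d.-homog -> pullback A g \is d.-homog.
Proof.
apply: dhomog_comp => i; rewrite tnth_mktuple; apply: rpred_sum => j _.
by rewrite rpredZ // dhomogX /= mdeg1.
Qed.

Lemma pullback_eval m (A : 'M[k]_m) (g : {mpoly k[m]}) (v : 'cV[k]_m) :
  (pullback A g).@[fun i => v i 0] = g.@[fun i => (A *m v) i 0].
Proof.
rewrite /pullback comp_mpoly_meval; apply: meval_eq => i.
rewrite tnth_mktuple raddf_sum mxE; apply: eq_bigr => j _ /=.
by rewrite mevalZ mevalXU.
Qed.

Definition from_poly : {poly {mpoly k[n.+1]}} -> {mpoly k[n.+2]} :=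
  horner_eval 'X_ord0 \o map_poly (@lift_form k n).
HB.instance Definition _ := GRing.RMorphism.on from_poly.

Definition to_poly : {mpoly k[n.+2]} -> {poly {mpoly k[n.+1]}} :=
  mmap (polyC \o @mpolyC n.+1 k) (fun i => if unlift ord0 i is Some j then ('X_j)%:P else 'X).
HB.instance Definition _ := GRing.RMorphism.on to_poly.

Lemma from_polyC p : from_poly p%:P = lift_form p.
Proof. by rewrite /from_poly /= map_polyC /= horner_evalE hornerC. Qed.

Lemma from_polyX : from_poly 'X = 'X_ord0.
Proof. by rewrite /from_poly /= map_polyX /= horner_evalE hornerX. Qed.

Lemma to_polyX0 : to_poly 'X_ord0 = 'X.
Proof. by rewrite /to_poly mmapX mmap1U unlift_none. Qed.

Lemma to_poly_lift p : to_poly (lift_form p) = p%:P.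
Proof.
apply: (@mpoly_rmorph_eq k n.+1 {poly {mpoly k[n.+1]}} (to_poly \o @lift_form k n) polyC).
  by move=> c; rewrite /= lift_formC /to_poly mmapC.
by move=> i; rewrite /= lift_formX /to_poly mmapX mmap1U liftK.
Qed.

Lemma from_polyK : cancel from_poly to_poly.
Proof.
apply: (@poly_rmorph_eq _ _ (to_poly \o from_poly) idfun) => [c|] /=.
  by rewrite from_polyC to_poly_lift.
by rewrite from_polyX to_polyX0.
Qed.

Lemma to_polyK : cancel to_poly from_poly.
Proof.
apply: (@mpoly_rmorph_eq _ _ _ (from_poly \o to_poly) idfun) => [c|i] /=.
  by rewrite -lift_formC to_poly_lift from_polyC.
have [j ->|->] := unliftP ord0 i; first by rewrite -lift_formX to_poly_lift from_polyC.
by rewrite to_polyX0 from_polyX.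
Qed.

End Forms.

(** * Affine substitutions and dehomogenization *)

Section Affine.
Variables (k : fieldType) (n : nat).
Implicit Types (p : {mpoly k[n.+1]}) (q : {poly {mpoly k[n.+1]}}).

Definition affine_poly (a : k) p : {poly {mpoly k[n.+1]}} := a%:MP *: 'X + p%:P.

(** The matrix of the substitution [X_0 |-> a X_0 + p] that fixes the other
coordinates, for [p] a linear form. *)
Definition affine_mx (a : k) p : 'M[k]_n.+2 :=
  \matrix_(i, j) if i == ord0 then (if unlift ord0 j is Some l then p@_U_(l) else a)
                 else (i == j)%:R.

Lemma pullback_affine_X0 a p : p \is 1.-homog ->
  pullback (affine_mx a p) 'X_ord0 = from_poly (affine_poly a p).
Proof.
move=> hp; rewrite /affine_poly -mul_polyC rmorphD rmorphM /= !from_polyC from_polyX.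
rewrite lift_formC mul_mpolyC pullbackX big_ord_recl; congr (_ + _).
  by rewrite mxE eqxx unlift_none.
rewrite [p in RHS](linear_formE hp) (rmorph_sum (@lift_form k n)); apply: eq_bigr => j _.
by rewrite mxE eqxx liftK -mul_mpolyC (rmorphM (@lift_form k n)) /= lift_formC lift_formX mul_mpolyC.
Qed.

Lemma pullback_affine_lift a p0 p : pullback (affine_mx a p0) (lift_form p) = lift_form p.
Proof.
apply: (@mpoly_rmorph_eq k n.+1 {mpoly k[n.+2]}
  (pullback (affine_mx a p0) \o @lift_form k n) (@lift_form k n)) => [c|j].
  by rewrite /= lift_formC pullbackC.
rewrite /= lift_formX pullbackX (bigD1 (lift ord0 j)) //= big1 => [|i ji].
  by rewrite mxE eqxx addr0 scale1r.
by rewrite mxE /= eq_sym (negPf ji) scale0r.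
Qed.

Lemma pullback_affine a p q : p \is 1.-homog ->
  pullback (affine_mx a p) (from_poly q) = from_poly (q \Po affine_poly a p).
Proof.
move=> hp; apply: (@poly_rmorph_eq _ _ (pullback (affine_mx a p) \o @from_poly k n)
  (@from_poly k n \o comp_poly (affine_poly a p))) => [c|] /=.
  by rewrite comp_polyC from_polyC pullback_affine_lift.
by rewrite comp_polyX from_polyX pullback_affine_X0.
Qed.

Lemma affine_mx_unit a p : a != 0 -> affine_mx a p \in unitmx.
Proof.
move=> a0; rewrite -unitmx_tr unitmxE det_trig.
  rewrite big_ord_recl !mxE eqxx unlift_none big1 ?mulr1 ?unitfE // => i _.
  by rewrite !mxE eqxx.
apply/is_trig_mxP => i j lt_ij; rewrite !mxE -val_eqE /= gtn_eqF ?(leq_ltn_trans _ lt_ij) //.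
by rewrite eq_sym; case: eqP lt_ij => // ->; rewrite ltnn.
Qed.

End Affine.

Section Model.
Variables (k : fieldType) (n : nat) (L : fieldType) (K : divringClosed L).
Variables (f : {poly {mpoly k[n.+1]}}).
Variables (phi : {rmorphism {mpoly k[n.+2]} -> L}) (base : {rmorphism {mpoly k[n.+1]} -> L}).

(** The part of the relation between forms and the function field [L] of [f = 0]
that the theory of [L] over [K] uses: [phi] divides a form of degree [d] by
[X_1^d], and [base] is its restriction to the coordinates of the target. Working
with an abstract field [L] keeps the construction of the function field as a
subtype of a fraction field out of the way. *)
Record projection_model : Prop := ProjectionModel {
  model_lift : forall p, phi (lift_form p) = base p;
  model_x1 : base 'X_ord0 = 1;
  model_base : forall p, base p \in K;
  model_quotient : forall z, z \in K -> exists d a b,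
    [/\ a \is d.-homog, b \is d.-homog, base b != 0 & z = base a / base b];
  model_gen : forall z, exists a b, z = phi a / phi b;
  model_zero : phi (from_poly f) = 0;
  model_kernel : forall g d, g \is d.-homog -> phi g = 0 -> divides (from_poly f) g
}.
Hypothesis M : projection_model.

Variables (D e : nat).
Hypotheses (homF : from_poly f \is D.-homog) (homl : lead_coef f \is e.-homog).
Hypothesis f_size : (1 < size f)%N.
Implicit Types (p : {mpoly k[n.+1]}) (g : {mpoly k[n.+2]}) (q : {poly {mpoly k[n.+1]}}).
Let t := phi 'X_ord0.
Let P := map_poly base f.

Lemma model_divides q d : from_poly q \is d.-homog -> phi (from_poly q) = 0 ->
  exists c, q = c * f.
Proof.
move=> hq /(model_kernel M hq)[c /(congr1 (@to_poly k n))].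
by rewrite rmorphM /= !from_polyK => ->; exists (to_poly c).
Qed.

Lemma model_divides_size q d : from_poly q \is d.-homog -> phi (from_poly q) = 0 ->
  q != 0 -> (size f <= size q)%N.
Proof.
move=> hq q0 nq; have [c qE] := model_divides hq q0.
have c0 : c != 0 by apply: contra_neq nq => c0; rewrite qE c0 mul0r.
have f0 : f != 0 by rewrite -size_poly_gt0 ltnW.
rewrite qE size_mul //; move: c0; rewrite -size_poly_gt0.
by case: (size c) => // m _; rewrite addSn /= leq_addl.
Qed.

(** A nonzero form in the coordinates of the target has degree 0 in [X_0], so it
is not a multiple of [f]. *)
Lemma model_base_inj p d : p \is d.-homog -> base p = 0 -> p = 0.
Proof.
move=> hp p0; apply/eqP/negPn/negP => np.
have := @model_divides_size p%:P d.
rewrite from_polyC lift_form_homog // (model_lift M) polyC_eq0 => /(_ isT p0 np).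
by rewrite size_polyC np leqNgt f_size.
Qed.

Lemma phi_from_poly q : phi (from_poly q) = (map_poly base q).[t].
Proof.
apply: (@poly_rmorph_eq _ _ (phi \o @from_poly k n) (horner_eval t \o map_poly base)).
  by move=> c; rewrite /= from_polyC map_polyC /= horner_evalE hornerC (model_lift M).
by rewrite /= from_polyX map_polyX horner_evalE hornerX.
Qed.

Lemma base_polyOver q : map_poly base q \is a polyOver K.
Proof. by apply/polyOverP => i; rewrite coef_map /=; apply: model_base. Qed.

(** The common denominator must be kept homogeneous, with all the numerators of
the same degree, since only forms can be compared with multiples of [f]. *)
Lemma clear_denominators (q : {poly L}) : q \is a polyOver K ->
  exists d b (h : {poly {mpoly k[n.+1]}}), [/\ b \is d.-homog, base b != 0,
    forall i, h`_i \is d.-homog & base b *: q = map_poly base h].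
Proof.
elim/poly_ind: q => [_|q c IH qK].
  exists 0%N, 1, 0; rewrite !rmorph1 oner_neq0 dhomog1 rmorph0 scaler0; split=> // i.
  by rewrite coef0 dhomog0.
have [|d [b [h [hb b0 hh E]]]] := IH.
  by apply/polyOverP => i; have := polyOverP qK i.+1; rewrite coefD coefMX coefC addr0.
have cK : c \in K by have := polyOverP qK 0; rewrite coefD coefMX coefC add0r.
have [e' [a [b' [ha hb' b'0 cE]]]] := model_quotient M cK.
exists (d + e')%N, (b * b'), (b' *: h * 'X + (a * b)%:P); split.
- exact: dhomogM.
- by rewrite rmorphM mulf_neq0.
- case=> [|i]; rewrite coefD coefMX coefC ?add0r ?addr0 /= ?coefZ addnC; exact: dhomogM.
rewrite (rmorphD (map_poly base)) (rmorphM (map_poly base)) /= map_polyZ map_polyX map_polyC /=.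
rewrite -E scalerDr !(rmorphM base).
rewrite -!scalerAl !scalerA [base b * base b']mulrC; congr (_ + _).
rewrite -mul_polyC -polyCM cE; congr (_%:P).
by field.
Qed.

Lemma base_lead : base (lead_coef f) != 0.
Proof.
have : lead_coef f != 0 by rewrite lead_coef_eq0 -size_poly_gt0 ltnW.
by apply: contra_neq; apply: model_base_inj homl.
Qed.

Lemma size_min : size P = size f.
Proof. by rewrite size_map_poly_id0 ?base_lead. Qed.

Lemma min_neq0 : P != 0.
Proof. by rewrite -size_poly_gt0 size_min ltnW. Qed.

Lemma min_root : root P t.
Proof. by rewrite rootE -phi_from_poly (model_zero M). Qed.

Lemma from_poly_homog q d : (size q <= d.+1)%N ->
  (forall i, (i < size q)%N -> q`_i \is (d - i).-homog) -> from_poly q \is d.-homog.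
Proof.
move=> sq hq; rewrite /from_poly /= horner_evalE.
rewrite (@horner_coef_wide _ (size q)) ?size_poly //; apply: rpred_sum => i _.
have le_id : (i <= d)%N by rewrite -ltnS (leq_trans (ltn_ord i)).
rewrite coef_map -[d](subnK le_id); apply: dhomogM.
  exact/lift_form_homog/hq.
by rewrite -[X in X.-homog]mul1n; apply: dhomogMn; rewrite dhomogX /= mdeg1.
Qed.

(** After clearing denominators, the relation [q.[t] = 0] becomes the vanishing
of a polynomial [h] at [t]. Multiplying the coefficients of [h] by powers of
[X_1] makes it a form without changing its value, and then [f] divides it. *)
Lemma min_minimal (q : {poly L}) : q \is a polyOver K -> q != 0 -> root q t ->
  (size P <= size q)%N.
Proof.
move=> qK q0 qt; have [d [b [h [hb b0 hh E]]]] := clear_denominators qK.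
have h0 : h != 0.
  by apply: contra_neq q0 => h0; apply: (scalerI b0); rewrite E h0 rmorph0 scaler0.
have lh0 : lead_coef h != 0 by rewrite lead_coef_eq0.
have sq : size q = size h.
  rewrite -(size_scale q b0) E size_map_poly_id0 //.
  by apply: contra_neq lh0; apply: model_base_inj (hh _).
pose x1 : {mpoly k[n.+1]} := 'X_ord0.
(* Here x1 has the value 1 in L; its powers only make h homogeneous. *)
pose h' := \poly_(i < size h) (h`_i * x1 ^+ (size h - i)).
have hE : map_poly base h' = map_poly base h.
  apply/polyP=> i; rewrite !coef_map coef_poly /=; case: ltnP => [_|le_i].
    by rewrite rmorphM rmorphXn /= (model_x1 M) expr1n mulr1.
  by rewrite nth_default.
rewrite size_min sq; apply: (leq_trans _ (size_poly _ _ : size h' <= _)%N).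
apply: (@model_divides_size _ (d + size h)).
- apply: from_poly_homog => [|i lt_i].
    by rewrite (leq_trans (size_poly _ _)) // leqW // leq_addl.
  have lt_ih : (i < size h)%N := leq_trans lt_i (size_poly _ _).
  rewrite coef_poly lt_ih -addnBA ?(ltnW lt_ih) //; apply: dhomogM => //.
  by rewrite -[X in X.-homog]mul1n; apply: dhomogMn; rewrite dhomogX /= mdeg1.
- by rewrite phi_from_poly hE -E hornerZ (rootP qt) mulr0.
- apply: contra_neq lh0 => /(congr1 (fun u : {poly _} => u`_(size h).-1)).
  rewrite coef_poly coef0 prednK ?size_poly_gt0 // leqnn => /eqP.
  rewrite mulf_eq0 expf_eq0 -[x1 == 0]msize_poly_eq0 msizeX andbF orbF => /eqP.
  by rewrite -lead_coefE.
Qed.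

Lemma model_fraction z : exists a b, [/\ a \is a polyOver K, b \is a polyOver K
  & z = a.[t] / b.[t]].
Proof.
have [a [b ->]] := model_gen M z.
exists (map_poly base (to_poly a)), (map_poly base (to_poly b)).
split; rewrite ?base_polyOver //.
have E g : (map_poly base (to_poly g)).[t] = phi g.
  transitivity (phi (from_poly (to_poly g))); last by rewrite to_polyK.
  by symmetry; apply: phi_from_poly.
congr (_ / _); symmetry; exact: E.
Qed.

Lemma phi_affine a p : phi (from_poly (affine_poly a p)) = base a%:MP * t + base p.
Proof.
rewrite phi_from_poly /affine_poly rmorphD /= map_polyZ map_polyX map_polyC.
by rewrite hornerD hornerZ hornerX hornerC.
Qed.

Lemma horner_affine a p q :
  (map_poly base q).[phi (from_poly (affine_poly a p))] =
  phi (from_poly (q \Po affine_poly a p)).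
Proof. by rewrite !phi_from_poly map_comp_poly horner_comp. Qed.

(** Both sides are ring morphisms on polynomials that agree on the constants and
the coordinates. *)
Lemma endo_pullback (s : {rmorphism L -> L}) a p : p \is 1.-homog -> {in K, s =1 id} ->
    s t = phi (from_poly (affine_poly a p)) ->
  forall g, s (phi g) = phi (pullback (affine_mx a p) g).
Proof.
move=> hp sK st.
apply: (@mpoly_rmorph_eq k n.+2 L (s \o phi) (phi \o pullback (affine_mx a p))) => [c|i] /=.
  by rewrite pullbackC -lift_formC (model_lift M) sK // (model_base M).
have [j ->|->] := unliftP ord0 i; last by rewrite -/t st pullback_affine_X0.
by rewrite -lift_formX pullback_affine_lift (model_lift M) sK // (model_base M).
Qed.

(** The roots [alpha a * t + beta a] are distinct, because [t] has degree
greater than 1 over [K], and there are as many as the degree of [f]. The cocycle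
condition on [beta] says that the substitutions compose like the elements of the
group. *)
Lemma affine_family_galois (gT : finGroupType) (alpha : gT -> k)
    (beta : gT -> {mpoly k[n.+1]}) :
    (forall a, beta a \is 1.-homog) -> injective (fun a => (alpha a, beta a)) ->
    (forall a b, alpha (a * b)%g = alpha a * alpha b) ->
    (forall a b, beta (a * b)%g = alpha b *: beta a + beta b) ->
    (forall a, f \Po affine_poly (alpha a) (beta a) = f) ->
    (2 < size f)%N -> size f = #|gT|.+1 ->
  [/\ galois_ext K, galois_group_isom K gT
    & forall s, galois_aut K s -> exists a, forall g,
        s (phi g) = phi (pullback (affine_mx (alpha a) (beta a)) g)].
Proof.
move=> hbeta injab alphaM betaM fab f2 szf.
pose rho a := phi (from_poly (affine_poly (alpha a) (beta a))).
have rhoE a : rho a = base (alpha a)%:MP * t + base (beta a) by apply: phi_affine.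
have baseC_inj (c : k) : base c%:MP = 0 -> c = 0.
  move=> c0; apply/eqP; rewrite -(mpolyC_eq0 n.+1); apply/eqP; apply: (model_base_inj (d := 0)) => //.
  exact: dhomogC.
have rho_inj : injective rho.
  move=> a b; rewrite !rhoE => /eqP E; apply: injab.
  pose q := (base (alpha a)%:MP - base (alpha b)%:MP) *: 'X + (base (beta a) - base (beta b))%:P.
  have qt : root q t.
    by rewrite rootE hornerD hornerZ hornerX hornerC mulrBl addrACA -opprD subr_eq0.
  have qK : q \is a polyOver K.
    by rewrite rpredD ?polyOverC ?polyOverZ ?polyOverX ?rpredB ?(model_base M).
  have sq : (size q <= 2)%N.
    rewrite (leq_trans (size_polyD _ _)) // geq_max (leq_trans (size_scale_leq _ _)) ?size_polyX //.
    by rewrite (leq_trans (size_polyC_leq1 _)).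
  have /eqP/polyP q0 : q == 0.
    apply: contraT => q0; have := min_minimal qK q0 qt.
    by rewrite size_min leqNgt (leq_ltn_trans sq f2).
  congr (_, _); apply/eqP; rewrite -subr_eq0; apply/eqP.
    apply: baseC_inj; have := q0 1%N; rewrite coefD coefZ coefX coefC coef0 mulr1 addr0.
    by rewrite mpolyCB (rmorphB base).
  apply: (model_base_inj (d := 1)); first by rewrite rpredB ?hbeta.
  by have := q0 0%N; rewrite coefD coefZ coefX coefC coef0 /= mulr0 add0r (rmorphB base).
have [| | |gal iso aut] := @root_family_galois L K t P (base_polyOver f) min_neq0 min_root
    min_minimal model_fraction gT rho rho_inj.
- by move=> a; rewrite rootE horner_affine fab (model_zero M).
- by rewrite size_min.
- move=> s a b [_ sK] st.
  have sb p : s (base p) = base p by apply: sK; apply: model_base.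
  rewrite [rho b]rhoE (rmorphD s) (rmorphM s) !sb st.
  rewrite !rhoE alphaM betaM -mul_mpolyC mpolyCM.
  rewrite (rmorphD base) !(rmorphM base).
  by ring.
split=> // s sG; have [a st] := aut s sG; exists a; case: sG => _ sK.
exact: endo_pullback.
Qed.

(** A root [a t + p] of [f] makes [f] divide its transform by [X_0 |-> a X_0 +
p], which has the same degree in [X_0]; comparing leading coefficients gives the
scalar. *)
Lemma galois_affine_maps : galois_ext K ->
    (forall s, galois_aut K s -> exists a p,
       [/\ a != 0, p \is 1.-homog & s t = phi (from_poly (affine_poly a p))]) ->
  exists S : seq (k * {mpoly k[n.+1]}), [/\ uniq S, size S = (size f).-1 &
    forall ap, ap \in S -> [/\ ap.1 != 0, ap.2 \is 1.-homog &
      f \Po affine_poly ap.1 ap.2 = (ap.1 ^+ (size f).-1)%:MP *: f]].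
Proof.
move=> gal aff.
have [rs Urs PE] := galois_split (base_polyOver f) min_neq0 min_root min_minimal gal.
have ex r : exists ap : k * {mpoly k[n.+1]}, r \in rs -> [/\ ap.1 != 0, ap.2 \is 1.-homog
    & r = phi (from_poly (affine_poly ap.1 ap.2))].
  have [rR|] := boolP (r \in rs); last by exists (0, 0).
  have [s sG <-] := root_aut (base_polyOver f) min_neq0 min_root min_minimal model_fraction Urs PE rR.
  by have [a [p [a0 hp st]]] := aff s sG; exists (a, p).
have [F FP] := choice ex; exists (map F rs); split.
- rewrite map_inj_in_uniq // => x y xR yR E.
  by have [_ _ ->] := FP x xR; have [_ _ ->] := FP y yR; rewrite E.
- by rewrite size_map -size_min (size_split min_neq0 PE).
move=> _ /mapP[r rR ->]; have [a0 hp rE] := FP r rR; split=> //.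
move: (F r) a0 hp rE => [a p] /= a0 hp rE.
have [||c cE] := @model_divides (f \Po affine_poly a p) D.
- by rewrite -pullback_affine // pullback_homog.
- by rewrite -horner_affine -rE; apply/rootP; rewrite (root_split min_neq0 PE).
have aM0 : a%:MP_[n.+1] != 0 by rewrite mpolyC_eq0.
have saff : size (affine_poly a p) = 2.
  by rewrite size_polyDl ?size_scale ?size_polyX // (leq_ltn_trans (size_polyC_leq1 _)).
have laff : lead_coef (affine_poly a p) = a%:MP.
  rewrite lead_coefDl ?lead_coefZ ?lead_coefX ?mulr1 //.
  by rewrite size_scale // size_polyX (leq_ltn_trans (size_polyC_leq1 _)).
have f0 : f != 0 by rewrite -size_poly_gt0 ltnW.
have c0 : c != 0.
  apply: contra_neq f0 => c0; apply/eqP; rewrite -size_poly_eq0.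
  by rewrite -(size_comp_poly2 f saff) cE c0 mul0r size_poly0.
have sc : size c = 1%N.
  have := size_comp_poly2 f saff; rewrite cE size_mul //.
  move: c0 f_size; rewrite -size_poly_gt0.
  by move: (size c) (size f) => [|[|u]] [|v] //= _ _; lia.
have /eqP/size_poly1P[c1 _ c1E] := sc.
have lf0 : lead_coef f != 0 by rewrite lead_coef_eq0.
have := @lead_coef_comp _ f (affine_poly a p); rewrite saff => /(_ isT).
rewrite cE c1E lead_coefM laff lead_coefC [RHS]mulrC => /(mulIf lf0) ->.
by rewrite mul_polyC rmorphXn.
Qed.

End Model.

(** * The function field of the hypersurface *)

Section ProjectionField.
Variables (k : fieldType) (n : nat) (X : hypersurface k n.+2).
Local Notation FX := (defining_form X).
Local Notation coord := Defs.coord.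

Local Notation frac := {fraction coord_ring X}.
Lemma val_ffB (x y : function_field X) : \val (x - y) = \val x - \val y :> frac.
Proof. exact: (rmorphB (val : subfield (rational_function (X:=X)) -> frac)). Qed.
Lemma val_ffM (x y : function_field X) : \val (x * y) = \val x * \val y :> frac.
Proof. exact: (rmorphM (val : subfield (rational_function (X:=X)) -> frac)). Qed.
Lemma val_ff1 : \val (1 : function_field X) = 1 :> frac.
Proof. exact: (rmorph1 (val : subfield (rational_function (X:=X)) -> frac)). Qed.
Lemma val_ff0 : \val (0 : function_field X) = 0 :> frac.
Proof. exact: (rmorph0 (val : subfield (rational_function (X:=X)) -> frac)). Qed.
Lemma val_ffV (x : function_field X) : \val (x^-1) = (\val x)^-1 :> frac.
Proof. exact: (fmorphV (val : subfield (rational_function (X:=X)) -> frac)). Qed.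

Lemma projection_field_divring : divring_closed (projection_field X).
Proof.
have ndM g h : ~ divides FX g -> ~ divides FX h -> ~ divides FX (g * h).
  move=> ng nh; rewrite -coord_eq0 rmorphM => /eqP; rewrite mulf_eq0.
  by case/orP=> /eqP/coord_eq0.
have nz g : ~ divides FX g -> coord X g != 0 by move=> ng; apply/eqP => /coord_eq0.
split.
- apply/asboolP; exists 0%N, 1, 1; rewrite val_ff1 !rmorph1 divr1 dhomog1; split=> //.
  by rewrite -coord_eq0 rmorph1 => /eqP; rewrite oner_eq0.
- move=> x y /asboolP[d [f [g [hf hg ng xE]]]] /asboolP[e [f' [g' [hf' hg' ng' yE]]]].
  apply/asboolP; exists (d + e)%N, (f * g' - f' * g), (g * g'); split.
  + by apply: rpredB; [|rewrite addnC]; apply: dhomogM.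
  + exact: dhomogM.
  + by rewrite rmorphM; apply: ndM.
  + by rewrite val_ffB xE yE -mulNr addf_div ?nz // mulNr !rmorphB !rmorphM.
- move=> x y /asboolP[d [f [g [hf hg ng xE]]]] /asboolP[e [f' [g' [hf' hg' ng' yE]]]].
  have [/coord_eq0 E|nf'] := pselect (divides FX (lift_form f')).
    apply/asboolP; exists d, 0, g; split; rewrite ?dhomog0 //.
    by rewrite val_ffM val_ffV yE E !rmorph0 !mul0r invr0 mulr0.
  apply/asboolP; exists (d + e)%N, (f * g'), (g * f'); split.
  + exact: dhomogM.
  + exact: dhomogM.
  + by rewrite rmorphM; apply: ndM.
  + by rewrite val_ffM val_ffV xE yE invf_div mulf_div !rmorphM.
Qed.

HB.instance Definition _ := GRing.isDivringClosed.Build (function_field X)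
  (projection_field X) projection_field_divring.

End ProjectionField.

Section Dehomogenization.
Variables (k : fieldType) (n : nat) (X : hypersurface k n.+2).
Variable f : {poly {mpoly k[n.+1]}}.
Local Notation FX := (defining_form X).
Local Notation coord := Defs.coord.
Local Notation lift_form := (@lift_form k n).
Hypotheses (fX : FX = from_poly f) (f_size : (1 < size f)%N).
Implicit Types (p : {mpoly k[n.+1]}) (g : {mpoly k[n.+2]}) (q : {poly {mpoly k[n.+1]}}).

Lemma divides_from_poly q : divides FX (from_poly q) -> exists c, q = c * f.
Proof.
case=> c /(congr1 (@to_poly k n)); rewrite rmorphM fX /= !from_polyK => ->.
by exists (to_poly c).
Qed.

(** The equation has positive degree in [X_0], so it divides no nonzero form in
the other coordinates. *)
Lemma coord_lift_eq0 p : coord X (lift_form p) = 0 -> p = 0.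
Proof.
move/coord_eq0; rewrite -from_polyC => /divides_from_poly[c E].
apply/eqP; rewrite -polyC_eq0 E; have [->|c0] := eqVneq c 0; first by rewrite mul0r.
have f0 : f != 0 by rewrite -size_poly_gt0 ltnW.
have := size_polyC_leq1 p; rewrite E size_mul //; move: c0 f_size; rewrite -size_poly_gt0.
by move: (size c) (size f) => [|u] [|[|v]] // _ _; lia.
Qed.

Let x1 := coord X (lift_form 'X_ord0).

Lemma x1_neq0 : x1 != 0.
Proof.
apply/eqP => /coord_lift_eq0 /(congr1 (mcoeff U_(ord0))) /eqP.
by rewrite mcoeffX eqxx mcoeff0 oner_eq0.
Qed.

(** Division of a form of degree [d] by [X_1^d], extended to all polynomials as
a ring morphism: each coordinate is divided by [X_1]. *)
Definition dehomog_frac : {mpoly k[n.+2]} -> {fraction coord_ring X} :=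
  mmap (coord X \o @mpolyC n.+2 k) (fun i => coord X 'X_i / x1).
HB.instance Definition _ := GRing.RMorphism.on dehomog_frac.

Lemma dehomog_frac_homog g d : g \is d.-homog -> dehomog_frac g = coord X g / x1 ^+ d.
Proof.
move=> /dhomogP hg; rewrite [g in coord X g]mpolyE rmorph_sum mulr_suml /dehomog_frac /mmap.
rewrite big_seq [RHS]big_seq; apply: eq_bigr => m mg; rewrite -mul_mpolyC rmorphM /= -mulrA.
congr (_ * _); rewrite -(hg _ mg) /= mpolyXE_id rmorph_prod mdegE -prodrXr -prodf_div /mmap1.
by apply: eq_bigr => i _; rewrite rmorphXn expr_div_n.
Qed.

Lemma dehomog_frac_rational g : dehomog_frac g \in rational_function (X:=X).
Proof.
rewrite /dehomog_frac /mmap; apply: rpred_sum => m _; apply: rpredM.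
  apply/asboolP; exists 0%N, (g@_m)%:MP, 1; rewrite dhomog1 rmorph1 divr1; split=> //.
    exact: dhomogC.
  by rewrite -coord_eq0 rmorph1 => /eqP; rewrite oner_eq0.
apply: rpred_prod => i _; apply: rpredX; apply/asboolP.
exists 1%N, 'X_i, (lift_form 'X_ord0); split; rewrite ?dhomogX /= ?mdeg1 //.
  by apply: lift_form_homog; rewrite dhomogX /= mdeg1.
by move/coord_eq0/eqP; rewrite (negPf x1_neq0).
Qed.

Definition dehomog g : function_field X :=
  exist (fun z => z \in rational_function (X:=X)) _ (dehomog_frac_rational g).

Lemma val_dehomog g : val (dehomog g) = dehomog_frac g. Proof. by []. Qed.

Lemma dehomog_zmod : zmod_morphism dehomog.
Proof. by move=> p q; apply: val_inj; rewrite val_ffB !val_dehomog rmorphB. Qed.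

Lemma dehomog_monoid : monoid_morphism dehomog.
Proof. by split=> [|p q]; apply: val_inj; rewrite ?val_ffM ?val_ff1 !val_dehomog ?rmorph1 ?rmorphM. Qed.

HB.instance Definition _ := GRing.isZmodMorphism.Build _ _ dehomog dehomog_zmod.
HB.instance Definition _ := GRing.isMonoidMorphism.Build _ _ dehomog dehomog_monoid.

Local Notation K := (projection_field X).
Definition base p : function_field X := dehomog (lift_form p).
HB.instance Definition _ := GRing.RMorphism.copy base (dehomog \o lift_form).

Lemma val_dehomog_homog g d : g \is d.-homog -> val (dehomog g) = coord X g / x1 ^+ d.
Proof. exact: dehomog_frac_homog. Qed.

Lemma dehomog_eq0 g d : g \is d.-homog -> dehomog g = 0 -> divides FX g.
Proof.
move=> hg /(congr1 val); rewrite (val_dehomog_homog hg) val_ff0 => /eqP.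
by rewrite mulf_eq0 invr_eq0 expf_eq0 (negPf x1_neq0) andbF orbF => /eqP/coord_eq0.
Qed.

Lemma base_inj p d : p \is d.-homog -> base p = 0 -> p = 0.
Proof. by move/lift_form_homog => hp /(dehomog_eq0 hp)/coord_eq0/coord_lift_eq0. Qed.

Lemma base_quotient a b d : a \is d.-homog -> b \is d.-homog -> b != 0 ->
  val (base a / base b) =
    coord X (lift_form a) / coord X (lift_form b).
Proof.
move=> ha hb b0; rewrite val_ffM val_ffV !(val_dehomog_homog (lift_form_homog ha)).
rewrite (val_dehomog_homog (lift_form_homog hb)) invf_div mulrA divfK //.
by rewrite expf_neq0 // x1_neq0.
Qed.

(** Membership is checked on the constants and on the ratios [X_i / X_1], since
[K] is a subring. *)
Lemma base_K p : base p \in K.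
Proof.
rewrite [p]mpolyE (rmorph_sum base); apply: rpred_sum => m _.
have mem a b d : a \is d.-homog -> b \is d.-homog -> b != 0 ->
    base a / base b \in K.
  move=> ha hb b0; apply/asboolP; exists d, a, b; split=> //; last exact: base_quotient hb b0.
  by move/coord_eq0/coord_lift_eq0/eqP; rewrite (negPf b0).
rewrite -mul_mpolyC rmorphM; apply: rpredM.
  have := mem (p@_m)%:MP 1 0%N; rewrite !rmorph1 divr1; apply; rewrite ?dhomog1 ?oner_eq0 //.
  exact: dhomogC.
rewrite mpolyXE_id rmorph_prod; apply: rpred_prod => i _; rewrite rmorphXn; apply: rpredX.
have x1E : base 'X_ord0 = 1.
  apply: val_inj; rewrite (@val_dehomog_homog _ 1) ?expr1 ?divff ?x1_neq0 ?val_ff1 //.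
  by apply: lift_form_homog; rewrite dhomogX /= mdeg1.
rewrite -[X in X \in _]divr1 -x1E; apply: (mem _ _ 1%N); rewrite ?dhomogX /= ?mdeg1 //.
by rewrite -msize_poly_eq0 msizeX.
Qed.

Lemma K_base z : z \in K -> exists d a b, [/\ a \is d.-homog, b \is d.-homog,
  base b != 0 & z = base a / base b].
Proof.
case/asboolP=> d [a [b [ha hb nb zE]]]; exists d, a, b.
have b0 : b != 0 by apply: contra_not_neq nb => ->; rewrite rmorph0; apply: divides0.
split=> //; first by apply: contra_neq b0; apply: base_inj hb.
by apply: val_inj; rewrite zE (base_quotient ha hb b0).
Qed.

Lemma divides_dehomog g d : g \is d.-homog -> divides FX g -> dehomog g = 0.
Proof.
move=> hg /coord_eq0 g0; apply: val_inj.
by rewrite (val_dehomog_homog hg) g0 mul0r val_ff0.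
Qed.

Lemma dehomog_quotient z a b d : a \is d.-homog -> b \is d.-homog ->
  \val z = coord X a / coord X b <-> z = dehomog a / dehomog b.
Proof.
move=> ha hb; have E : \val (dehomog a / dehomog b) = coord X a / coord X b.
  rewrite val_ffM val_ffV !(val_dehomog_homog ha) (val_dehomog_homog hb).
  by rewrite invf_div mulrA divfK // expf_neq0 // x1_neq0.
by split=> [zE|->]; [apply: val_inj; rewrite zE E|].
Qed.

Lemma function_field_model :
  projection_model (projection_field X) f dehomog base.
Proof.
split=> //.
- apply: val_inj; rewrite (@val_dehomog_homog _ 1) ?expr1 ?divff ?x1_neq0 ?val_ff1 //.
  by apply: lift_form_homog; rewrite dhomogX /= mdeg1.
- exact: base_K.
- exact: K_base.
- move=> z; have /asboolP[d [a [b [ha hb nb zE]]]] := valP z; exists a, b.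
  exact/(dehomog_quotient z ha hb).
- rewrite -fX; have := form_homog X; rewrite homog_msize => hF.
  by apply: (divides_dehomog hF); exists 1; rewrite mul1r.
- by move=> g d hg /(dehomog_eq0 hg); rewrite fX.
Qed.

End Dehomogenization.

(** * Extendable automorphisms are affine substitutions *)

Lemma rmorph_quotient (k : fieldType) m (L : fieldType) (g : {rmorphism {mpoly k[m]} -> L})
  c u v : c != 0 -> g (c%:MP * u) / g (c%:MP * v) = g u / g v.
Proof.
move=> c0; have gc : g c%:MP * g c^-1%:MP = 1.
  by rewrite -rmorphM -mpolyCM mulfV // rmorph1.
have gc0 : g c%:MP != 0.
  by apply: contra_eq_neq gc => ->; rewrite mul0r eq_sym oner_eq0.
by rewrite !rmorphM -mulf_div divff // mul1r.
Qed.

Section Extendable.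
Variables (k : fieldType) (n : nat) (X : hypersurface k n.+2).
Variables (f : {poly {mpoly k[n.+1]}}) (D e : nat).
Local Notation FX := (defining_form X).
Local Notation coord := Defs.coord.
Hypotheses (fX : FX = from_poly f) (homF : FX \is D.-homog) (D2 : (2 < D)%N).
Hypotheses (homl : lead_coef f \is e.-homog) (f_size : (2 < size f)%N).

Let f1 : (1 < size f)%N := ltnW f_size.
Let phi := dehomog fX f1.
Let M := function_field_model fX f1.
Let homf : from_poly f \is D.-homog. Proof. by rewrite -fX. Qed.

Lemma affine_preserves a p : p \is 1.-homog -> f \Po affine_poly a p = f ->
  preserves X (affine_mx a p).
Proof.
move=> hp E v; rewrite /on_hypersurface -pullback_eval fX pullback_affine // E.
by split.
Qed.

(** A rational function is a quotient of two forms of the same degree, and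
dividing both by the same power of [X_1] writes it as a quotient of values of
[phi]. *)
Lemma affine_induces (A : 'M[k]_n.+2) (s : {rmorphism function_field X -> function_field X}) :
  (forall g, s (phi g) = phi (pullback A g)) -> induces A s.
Proof.
move=> sE z d a b ha hb nb /(dehomog_quotient fX f1 z ha hb) zE.
have nAb : ~ divides FX (pullback A b).
  move/(divides_dehomog fX f1 (pullback_homog A hb)).
  rewrite -[dehomog _ _ _]/(phi _) -sE => /eqP; rewrite fmorph_eq0 => /eqP.
  by move/(dehomog_eq0 hb).
split=> //; apply/(dehomog_quotient fX f1 _ (pullback_homog A ha) (pullback_homog A hb)).
by rewrite zE fmorph_div; congr (_ / _); apply: sE.
Qed.

Lemma affine_family_extendable (gT : finGroupType) (alpha : gT -> k)
    (beta : gT -> {mpoly k[n.+1]}) :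
    (forall a, alpha a != 0) -> (forall a, beta a \is 1.-homog) ->
    injective (fun a => (alpha a, beta a)) ->
    (forall a b, alpha (a * b)%g = alpha a * alpha b) ->
    (forall a b, beta (a * b)%g = alpha b *: beta a + beta b) ->
    (forall a, f \Po affine_poly (alpha a) (beta a) = f) -> size f = #|gT|.+1 ->
  extendable_galois_point X /\ galois_group_isom (projection_field X) gT.
Proof.
move=> halpha hbeta inj alphaM betaM fab szf.
have [gal iso aut] := affine_family_galois M homl f1 hbeta inj alphaM betaM fab f_size szf.
split=> //; split=> // s sG; have [a sE] := aut s sG.
exists (affine_mx (alpha a) (beta a)); split.
- exact: affine_mx_unit.
- exact: affine_preserves.
- exact: affine_induces.
Qed.

Lemma divides_small g d : g \is d.-homog -> (d < D)%N -> divides FX g -> g = 0.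
Proof.
move=> hg lt_dD [c gE]; apply/eqP/negPn/negP => g0.
have c0 : c != 0 by apply: contra_neq g0 => c0; rewrite gE c0 mul0r.
have F0 : FX != 0 by apply: contra_neq g0 => F0; rewrite gE F0 mulr0.
have := msizeM c0 F0; rewrite -gE.
have dE := dhomog_uniq g0 hg (dhomog_msize hg).
have DE := dhomog_uniq F0 homF (dhomog_msize homF).
move: lt_dD; rewrite {}dE {}DE; move: c0 F0; rewrite -!msize_poly_eq0.
by move: (msize c) (msize FX) (msize g) => [|u] [|v] [|w] //= _ _; lia.
Qed.

(** The automorphism fixes the ratios [X_i / X_1], so [A(X_i) X_1 = A(X_1) X_i]
modulo the equation, hence exactly, by degree. Evaluating this identity for two
different indices on vectors with [v_1 = 0] shows that [A(X_1)] is a multiple of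
[X_1], and then each [A(X_i)] is the same multiple of [X_i]. *)
Lemma extendable_affine (s : {rmorphism function_field X -> function_field X}) A :
    (1 <= n)%N -> galois_aut (projection_field X) s -> A \in unitmx -> induces A s ->
  exists a p, [/\ a != 0, p \is 1.-homog & s (phi 'X_ord0) = phi (from_poly (affine_poly a p))].
Proof.
move=> n1 [_ sK] Au sA.
pose i1 : 'I_n.+2 := lift ord0 ord0.
have hX (i : 'I_n.+2) : ('X_i : {mpoly k[n.+2]}) \is 1.-homog by rewrite dhomogX /= mdeg1.
have nX1 : ~ divides FX 'X_i1.
  rewrite -lift_formX => /coord_eq0/(coord_lift_eq0 fX f1)/eqP.
  by rewrite -msize_poly_eq0 msizeX.
have ratio (i : 'I_n.+1) :
    pullback A 'X_(lift ord0 i) * 'X_i1 = pullback A 'X_i1 * 'X_(lift ord0 i).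
  have zE := (dehomog_quotient fX f1 (phi 'X_(lift ord0 i) / phi 'X_i1) (hX _) (hX i1)).2 erefl.
  have [nA] := sA _ _ _ _ (hX _) (hX _) nX1 zE; rewrite sK; last first.
    rewrite /phi -!lift_formX; apply: rpred_div; exact: (model_base M).
  rewrite zE => /eqP; rewrite eqr_div; last 2 first.
  - by apply/eqP => /coord_eq0.
  - by apply/eqP => /coord_eq0.
  rewrite -!rmorphM -subr_eq0 -rmorphB => /eqP/coord_eq0 dv.
  apply/esym/eqP; rewrite [X in X == _]mulrC -subr_eq0; apply/eqP; apply: divides_small D2 dv.
  have hom2 u v : u \is 1.-homog -> v \is 1.-homog -> u * v \is [in k[n.+2], 2.-homog].
    exact: dhomogM.
  by apply: rpredB; apply: hom2; rewrite ?pullback_homog.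
(* A second coordinate of the target, distinct from the first one. *)
pose i2 : 'I_n.+2 := lift ord0 ord_max.
have i21 : i2 != i1.
  by rewrite (inj_eq (@lift_inj _ ord0)) -val_eqE /= -lt0n.
have eval2 (v : 'cV[k]_n.+2) : v i1 0 = 0 -> v i2 0 = 1 -> (A *m v) i1 0 = 0.
  move=> v1 v2; have /(congr1 (fun u => u.@[fun i => v i 0])) := ratio ord_max.
  by rewrite !mevalM !pullback_eval !mevalXU v1 v2 mulr0 mulr1 => <-.
have mx_delta (i j : 'I_n.+2) : (A *m delta_mx j 0 : 'cV[k]_n.+2) i 0 = A i j.
  by rewrite -colE mxE.
have addE (u v : 'cV[k]_n.+2) i : (u + v) i 0 = u i 0 + v i 0 by rewrite mxE.
have Ai2 : A i1 i2 = 0.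
  rewrite -mx_delta; apply: eval2; rewrite mxE eqxx ?andbT ?eqxx //.
  by rewrite eq_sym (negPf i21).
have row1 j : j != i1 -> A i1 j = 0.
  move=> j1; have [->//|j2] := eqVneq j i2.
  have := eval2 (delta_mx j 0 + delta_mx i2 0); rewrite mulmxDr !addE !mx_delta Ai2 addr0.
  apply; rewrite !mxE ?eqxx ?andbT ?[_ == j]eq_sym ?(negPf j1) ?(negPf j2) ?add0r //.
  by rewrite eq_sym (negPf i21).
pose lam := A i1 i1.
have pX1 : pullback A 'X_i1 = lam *: 'X_i1.
  by rewrite pullbackX (bigD1 i1) //= big1 ?addr0 // => j /row1->; rewrite scale0r.
have X1n0 : ('X_i1 : {mpoly k[n.+2]}) != 0 by rewrite -msize_poly_eq0 msizeX.
have pX i : pullback A 'X_(lift ord0 i) = lam *: 'X_(lift ord0 i).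
  by apply: (mulIf X1n0); rewrite ratio pX1 -!scalerAl mulrC.
have phiX1 : phi 'X_i1 = 1 by rewrite -lift_formX; apply: (model_x1 M).
have zE := (dehomog_quotient fX f1 (phi 'X_ord0 / phi 'X_i1) (hX _) (hX i1)).2 erefl.
have [nA sE] := sA _ _ _ _ (hX _) (hX _) nX1 zE.
have lam0 : lam != 0.
  by apply: contra_not_neq nA => lam0; rewrite pX1 lam0 scale0r; apply: divides0.
have {}sE := (dehomog_quotient fX f1 _ (pullback_homog A (hX _)) (pullback_homog A (hX _))).1 sE.
pose p : {mpoly k[n.+1]} := \sum_j (A ord0 (lift ord0 j) / lam) *: 'X_j.
have hp : p \is 1.-homog.
  by apply: rpred_sum => j _; rewrite rpredZ // dhomogX /= mdeg1.
exists (A ord0 ord0 / lam), p; split=> //.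
  rewrite mulf_neq0 ?invr_eq0 //; apply/eqP => A00.
  have : A *m delta_mx ord0 0 = 0 :> 'cV[k]_n.+2.
    apply/matrixP => i j; rewrite ord1 mx_delta mxE.
    have [l ->|-> //] := unliftP ord0 i.
    have /(congr1 (fun u => u.@[fun i => (delta_mx ord0 0 : 'cV[k]_n.+2) i 0])) := pX l.
    by rewrite pullback_eval mevalXU mx_delta mevalZ mevalXU mxE mulr0.
  move/(congr1 (mulmx (invmx A))); rewrite mulKmx // mulmx0 => /matrixP/(_ ord0 0)/eqP.
  by rewrite !mxE oner_eq0.
have pX0 : pullback A 'X_ord0 = lam%:MP * from_poly (affine_poly (A ord0 ord0 / lam) p).
  rewrite -pullback_affine_X0 // mul_mpolyC !pullbackX scaler_sumr; apply: eq_bigr => j _.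
  rewrite scalerA mxE eqxx; congr (_ *: _); have [l ->|->] := unliftP ord0 j.
    rewrite raddf_sum (bigD1 l) //= big1 => [|i il].
      by rewrite mcoeffZ mcoeffX eqxx mulr1 addr0 mulrC divfK.
    rewrite mcoeffZ mcoeffX; case: eqP => [/mnmP/(_ i)|]; last by rewrite mulr0.
    by rewrite !mnm1E eqxx eq_sym (negPf il).
  by rewrite mulrC divfK.
have phiQ := rmorph_quotient phi _ _ lam0.
have tE : phi 'X_ord0 = phi 'X_ord0 / phi 'X_i1 by rewrite phiX1 divr1.
rewrite tE sE pX1 pX0 -mul_mpolyC -/phi.
exact: (etrans (phiQ _ _) (etrans (congr1 (fun w => phi _ / w) phiX1) (divr1 _))).
Qed.

Lemma extendable_affine_maps : (1 <= n)%N -> extendable_galois_point X ->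
  exists S : seq (k * {mpoly k[n.+1]}), [/\ uniq S, size S = (size f).-1 &
    forall ap, ap \in S -> [/\ ap.1 != 0, ap.2 \is 1.-homog &
      f \Po affine_poly ap.1 ap.2 = (ap.1 ^+ (size f).-1)%:MP *: f]].
Proof.
move=> n1 [gal ext]; apply: (galois_affine_maps M homf homl f1 gal) => s sG.
have [A [Au _ sA]] := ext s sG.
by have [a [p [a0 hp st]]] := extendable_affine n1 sG Au sA; exists a, p.
Qed.

End Extendable.

(** * Factors of forms, and values at the center *)

Section FormLemmas.
Variables (k : fieldType) (n : nat).
Implicit Types (p q r : {mpoly k[n]}).

Lemma dhomog_msizeE p d : p != 0 -> p \is d.-homog -> msize p = d.+1.
Proof.
move=> p0 hp; rewrite (dhomog_uniq p0 hp (dhomog_msize hp)) prednK //.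
by rewrite lt0n msize_poly_eq0.
Qed.

Lemma unit_mpolyC p : msize p = 1%N -> p \is a GRing.unit.
Proof.
move/eqP/msize_poly1P => [c c0 ->]; apply/unitrPr; exists (c^-1)%:MP.
by rewrite -mpolyCM mulfV.
Qed.

(** Linear forms are irreducible for degree reasons, and polynomial rings are
factorial. *)
Lemma linear_form_prime p : p \is 1.-homog -> p != 0 -> prime_elt p.
Proof.
move=> hp p0; apply: irreducible_prime; first exact: factorial_mpoly.
have sp := dhomog_msizeE p0 hp; split.
  apply/negP => /unitrPr[q pq]; have q0 : q != 0.
    by apply: contra_eq_neq pq => ->; rewrite mulr0 eq_sym oner_eq0.
  by have := msizeM p0 q0; rewrite pq msize1 sp; move: q0; rewrite -msize_poly_eq0; lia.
move=> b c pE; have b0 : b != 0 by apply: contra_neq p0 => b0; rewrite pE b0 mul0r.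
have c0 : c != 0 by apply: contra_neq p0 => c0; rewrite pE c0 mulr0.
have := msizeM b0 c0; rewrite -pE sp; move: b0 c0; rewrite -!msize_poly_eq0 => b0 c0 E.
have [b1|b1] := eqVneq (msize b) 1%N; [left | right]; apply: unit_mpolyC => //.
by move: b0 c0 b1 E; move: (mmeasure _ b) (mmeasure _ c) => u v; lia.
Qed.

(** The cofactor can be replaced by its component of degree [e], because
multiplication by [p] shifts all degrees by [d]. *)
Lemma dhomog_factor p q r d e : p \is d.-homog -> q \is (d + e).-homog -> q = r * p ->
  exists2 r', r' \is e.-homog & q = r' * p.
Proof.
move=> hp hq qE; exists (pihomog mdeg e r); first exact: pihomogP.
have lt_e : (e < msize r + e.+1)%N by rewrite addnS ltnS leq_addl.
rewrite -[LHS](pihomog_dE hq) qE [in LHS](@pihomog_partitionE _ _ mdeg (msize r + e.+1) r).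
  rewrite mulr_suml raddf_sum /= (bigD1 (Ordinal lt_e)) //= big1 => [|i ie].
    by rewrite addr0 pihomog_dE // addnC; apply: dhomogM => //; apply: pihomogP.
  apply: (@pihomog_ne0 _ _ mdeg (i + d)%N); last by apply: dhomogM => //; apply: pihomogP.
  by apply: contra ie; rewrite addnC eqn_add2l -val_eqE.
by rewrite leq_addr.
Qed.

(** In a relation between three nonzero forms no degree can occur only once, so
the three degrees agree; the degree of the product then determines them. *)
Lemma three_forms_homog p q r : p \is homog mdeg -> q \is homog mdeg -> r \is homog mdeg ->
    p != 0 -> q != 0 -> r != 0 -> p + q + r = 0 -> p * q * r \is 3.-homog ->
  [/\ p \is 1.-homog, q \is 1.-homog & r \is 1.-homog].
Proof.
move=> /homogP[a ha] /homogP[b hb] /homogP[c hc] p0 q0 r0 s0 h3.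
have same (u v w : {mpoly k[n]}) i j l : u \is i.-homog -> v \is j.-homog -> w \is l.-homog -> u != 0 ->
    u + v + w = 0 -> i = j \/ i = l.
  move=> hu hv hw u0 E; have [->|ij] := eqVneq i j; first by left.
  have [->|il] := eqVneq i l; first by right.
  case/eqP: u0; rewrite -[LHS](pihomog_dE hu) -[RHS](pihomog0 _ mdeg i) -E !pihomogD.
  by rewrite (pihomog_ne0 _ hv) ?(pihomog_ne0 _ hw) ?addr0 // eq_sym.
have E1 := same _ _ _ _ _ _ ha hb hc p0 s0.
have E2 : b = a \/ b = c by apply: (same q p r _ _ _ hb ha hc q0); rewrite [q + p]addrC.
have E3 : c = a \/ c = b.
  by apply: (same r p q _ _ _ hc ha hb r0); rewrite -addrA addrC.
have [ab ac] : a = b /\ a = c by move: E1 E2 E3; lia.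
subst b c; have pq0 : p * q * r != 0 by rewrite !mulf_neq0.
have := dhomog_uniq pq0 h3 (dhomogM (dhomogM ha hb) hc) => a3.
have a1 : a = 1%N by lia.
by subst a.
Qed.

Lemma meval0_homog p d : p \is d.-homog -> (0 < d)%N -> p.@[fun=> 0] = 0.
Proof.
move=> /dhomogP hp d0; rewrite mevalE big_seq big1 // => m /hp /= mE.
have : mdeg m != 0%N by rewrite mE -lt0n.
rewrite mdeg_eq0 => m0; have [i mi] : exists i, m i != 0%N.
  apply/existsP; apply: contraR m0 => /existsPn h.
  by apply/eqP/mnmP => i; rewrite mnm0E; apply/eqP; move: (h i); rewrite negbK.
by rewrite (bigD1 i) //= expr0n (negPf mi) mul0r mulr0.
Qed.

End FormLemmas.

Section Center.
Variables (k : fieldType) (n : nat).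
Implicit Types (p : {mpoly k[n.+1]}).
Local Notation center := (fun i : 'I_n.+2 => proj_center k n i 0).

Lemma meval_lift_center p : (lift_form p).@[center] = p.@[fun=> 0].
Proof.
rewrite /lift_form comp_mpoly_meval; apply: meval_eq => j.
by rewrite tnth_mktuple mevalXU mxE.
Qed.

Lemma center_ord0 : proj_center k n ord0 0 = 1. Proof. by rewrite mxE. Qed.

(** Every monomial of degree at least 2 in the coordinates vanishing at the
center is a product of two factors that vanish there. *)
Lemma mderiv_lift_center p d i : p \is d.-homog -> (1 < d)%N ->
  (lift_form p)^`M(i).@[center] = 0.
Proof.
move=> hp d1; rewrite [p]mpolyE big_seq (rmorph_sum (@lift_form k n)) (raddf_sum (mderiv i)).
rewrite (raddf_sum (meval center)) big1 //= => m mp.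
have md : mdeg m = d := dhomogP _ _ _ hp m mp.
have [a ma] : exists a, m a != 0%N.
  apply/existsP; apply: contraPT d1 => /existsPn h; rewrite -md.
  suff -> : m = 0%MM by rewrite mdeg0.
  by apply/mnmP => j; rewrite mnm0E; apply/eqP; move: (h j); rewrite negbK.
have mE : m = (U_(a) + (m - U_(a)))%MM.
  by rewrite addmC submK //; apply/mnm_lepP => j; rewrite mnm1E; case: eqP => // <-; rewrite lt0n.
rewrite -mul_mpolyC (rmorphM (@lift_form k n)) /= lift_formC mderiv_mulC mevalM mE mpolyXD.
rewrite (rmorphM (@lift_form k n)) /= mderivM mevalD !mevalM !meval_lift_center mevalXU.
rewrite (@meval0_homog _ _ 'X_[m - U_(a)] d.-1) ?mulr0 ?mul0r ?addr0 ?mulr0 //.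
  by rewrite dhomogX /=; move/(congr1 mdeg): mE; rewrite mdegD mdeg1 md => ->.
by rewrite -ltnS prednK // ltnW.
Qed.

End Center.

(** * Affine symmetries of cubic and quartic polynomials *)

Section Quartic.
Variable R : comNzRingType.
Implicit Types (a b c d e s p : R).

Definition quartic a b c d e : {poly R} := Poly [:: e; d; c; b; a].

Lemma quarticE a b c d e :
  quartic a b c d e = a *: 'X^4 + b *: 'X^3 + c *: 'X^2 + d *: 'X + e%:P.
Proof.
apply/polyP => i; rewrite coef_Poly !coefD !coefZ !coefXn coefX coefC.
by case: i => [|[|[|[|[|i]]]]] /=; rewrite ?nth_nil ?mulr0 ?mulr1 ?add0r ?addr0.
Qed.

Lemma quartic_inj a b c d e a' b' c' d' e' :
  quartic a b c d e = quartic a' b' c' d' e' ->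
  [/\ a = a', b = b', c = c', d = d' & e = e'].
Proof.
move=> /polyP E; split; [have := E 4%N|have := E 3%N|have := E 2%N|have := E 1%N|have := E 0%N];
  by rewrite !coef_Poly.
Qed.

Lemma scale_quartic s a b c d e :
  s *: quartic a b c d e = quartic (s * a) (s * b) (s * c) (s * d) (s * e).
Proof.
apply/polyP => i; rewrite coefZ !coef_Poly.
by case: i => [|[|[|[|[|i]]]]] //=; rewrite nth_nil mulr0.
Qed.

Lemma horner_quartic a b c d e p :
  (quartic a b c d e).[p] = a * p ^+ 4 + b * p ^+ 3 + c * p ^+ 2 + d * p + e.
Proof. by rewrite quarticE !hornerE. Qed.

Lemma quartic_comp a b c d e s p :
  quartic a b c d e \Po (s *: 'X + p%:P) = quartic (a * s ^+ 4)
    (4%:R * a * s ^+ 3 * p + b * s ^+ 3)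
    (6%:R * a * s ^+ 2 * p ^+ 2 + 3%:R * b * s ^+ 2 * p + c * s ^+ 2)
    (4%:R * a * s * p ^+ 3 + 3%:R * b * s * p ^+ 2 + 2%:R * c * s * p + d * s)
    (a * p ^+ 4 + b * p ^+ 3 + c * p ^+ 2 + d * p + e).
Proof.
rewrite !quarticE !comp_polyD !comp_polyZ !comp_Xn_poly comp_polyX comp_polyC.
rewrite -!mul_polyC !(polyCD, polyCM, polyC_exp, polyC_natr); ring.
Qed.

End Quartic.

Section Equations.
Variable R : idomainType.
Implicit Types (a b c d e s p m : R).

(** The map is the homothety of ratio [s] about [- m]. In the variable ['X + m]
the quadratic term vanishes because [s <> 1], the constant term does not vanish
because [- m] is no root, so [s^3 = 1], and then the linear term vanishes
because [s <> s^3]. *)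
Lemma cubic_homothety b c d e s p m :
    b != 0 -> s != 0 -> s != 1 -> p = (s - 1) * m ->
    (forall q, ~~ root (quartic 0 b c d e) q) ->
    quartic 0 b c d e \Po (s *: 'X + p%:P) = s ^+ 3 *: quartic 0 b c d e ->
  [/\ s ^+ 3 = 1, c = 3%:R * b * m & d = 3%:R * b * m ^+ 2].
Proof.
move=> b0 s0 s1 -> nroot; rewrite quartic_comp scale_quartic => /quartic_inj[_ _ E2 E1 E0].
have s10 : s - 1 != 0 by rewrite subr_eq0.
have cE : c = 3%:R * b * m.
  apply: (mulfI s10); apply: (mulfI (expf_neq0 2 s0)); apply/eqP; rewrite -subr_eq0.
  by apply/eqP; move/eqP: E2; rewrite -subr_eq0 => /eqP E2; rewrite -[RHS]oppr0 -[in RHS]E2; ring.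
(* g1 and g are the coefficients of degree 1 and 0 in the variable 'X + m. *)
have [g1 dE] : exists g1, d = g1 + 3%:R * b * m ^+ 2.
  by exists (d - 3%:R * b * m ^+ 2); rewrite subrK.
have [g eE] : exists g, e = g + (g1 * m + b * m ^+ 3).
  by exists (e - (g1 * m + b * m ^+ 3)); rewrite subrK.
have {nroot} g0 : g != 0.
  have := nroot (- m); rewrite rootE horner_quartic cE dE eE; apply: contra_neq => ->.
  by ring.
subst c d e.
have g1E : g1 * (s - s ^+ 3) = 0.
  by move/eqP: E1; rewrite -subr_eq0 => /eqP <-; ring.
have s3 : s ^+ 3 = 1.
  apply/esym/eqP; rewrite -subr_eq0; apply/eqP/(mulfI g0); rewrite mulr0.
  transitivity (g * (1 - s ^+ 3) + m * (g1 * (s - s ^+ 3))); first by rewrite g1E mulr0 addr0.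
  by move/eqP: E0; rewrite -subr_eq0 => /eqP <-; ring.
split=> //; move/eqP: g1E; rewrite s3 mulf_eq0 (negPf s10) orbF => /eqP ->.
by rewrite add0r.
Qed.

Lemma cubic_translation b c d e p : 3%:R = 0 :> R -> p != 0 ->
    quartic 0 b c d e \Po (1 *: 'X + p%:P) = quartic 0 b c d e ->
  c = 0 /\ d = - (p ^+ 2 * b).
Proof.
move=> r3 p0; rewrite quartic_comp => /quartic_inj[_ _ _ E1 E0].
have cE : c = 0.
  apply: (mulIf p0); rewrite mul0r; move/eqP: E1; rewrite -subr_eq0 => /eqP E1.
  by transitivity (3%:R * (c * p + b * p ^+ 2) - 0); [rewrite -E1; ring | rewrite r3; ring].
split=> //; apply: (mulIf p0); move/eqP: E0; rewrite -subr_eq0 => /eqP E0.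
by apply/eqP; rewrite -subr_eq0 -[X in _ == X]E0 cE; apply/eqP; ring.
Qed.

(** As for cubics, in the variable ['X + m] the cubic term vanishes, the
constant term forces [s^4 = 1] and the linear term vanishes; the quadratic term
survives only if [s^2 = 1]. *)
Lemma quartic_homothety b c d e s p m :
    s != 0 -> s != 1 -> p = (s - 1) * m ->
    (forall q, ~~ root (quartic 1 b c d e) q) ->
    quartic 1 b c d e \Po (s *: 'X + p%:P) = s ^+ 4 *: quartic 1 b c d e ->
  [/\ s ^+ 4 = 1, b = 4%:R * m, (c - 6%:R * m ^+ 2) * (s ^+ 2 - 1) = 0
    & d = 4%:R * m ^+ 3 + 2%:R * (c - 6%:R * m ^+ 2) * m].
Proof.
move=> s0 s1 -> nroot; rewrite quartic_comp scale_quartic => /quartic_inj[_ E3 E2 E1 E0].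
have s10 : s - 1 != 0 by rewrite subr_eq0.
have bE : b = 4%:R * m.
  apply: (mulfI s10); apply: (mulfI (expf_neq0 3 s0)); apply/eqP; rewrite -subr_eq0.
  by apply/eqP; move/eqP: E3; rewrite -subr_eq0 => /eqP E3; rewrite -[RHS]oppr0 -[in RHS]E3; ring.
(* g2, g1 and g are the coefficients of degree 2, 1 and 0 in the variable 'X + m. *)
have [g2 cE] : exists g2, c = g2 + 6%:R * m ^+ 2 by exists (c - 6%:R * m ^+ 2); rewrite subrK.
have [g1 dE] : exists g1, d = g1 + (4%:R * m ^+ 3 + 2%:R * g2 * m).
  by exists (d - (4%:R * m ^+ 3 + 2%:R * g2 * m)); rewrite subrK.
have [g eE] : exists g, e = g + (g1 * m + g2 * m ^+ 2 + m ^+ 4).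
  by exists (e - (g1 * m + g2 * m ^+ 2 + m ^+ 4)); rewrite subrK.
have {nroot} g0 : g != 0.
  have := nroot (- m); rewrite rootE horner_quartic bE cE dE eE; apply: contra_neq => ->.
  by ring.
subst b c d e.
have g2E : g2 * (s ^+ 2 - s ^+ 4) = 0.
  by move/eqP: E2; rewrite -subr_eq0 => /eqP <-; ring.
have g1E : g1 * (s - s ^+ 4) = 0.
  transitivity (g1 * (s - s ^+ 4) + 2%:R * m * (g2 * (s ^+ 2 - s ^+ 4))).
    by rewrite g2E mulr0 addr0.
  by move/eqP: E1; rewrite -subr_eq0 => /eqP <-; ring.
have s4 : s ^+ 4 = 1.
  apply/esym/eqP; rewrite -subr_eq0; apply/eqP/(mulfI g0); rewrite mulr0.
  transitivity (g * (1 - s ^+ 4) + m * (g1 * (s - s ^+ 4)) + m ^+ 2 * (g2 * (s ^+ 2 - s ^+ 4))).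
    by rewrite g1E g2E !mulr0 !addr0.
  by move/eqP: E0; rewrite -subr_eq0 => /eqP <-; ring.
move: g1E g2E; rewrite s4 => /eqP g1E g2E; split=> //.
  by rewrite -[RHS]g2E; ring.
move: g1E; rewrite mulf_eq0 (negPf s10) orbF => /eqP ->.
by ring.
Qed.

Lemma quartic_translation b c d e p : 2%:R = 0 :> R -> p != 0 ->
    quartic 1 b c d e \Po (1 *: 'X + p%:P) = quartic 1 b c d e ->
  b = 0 /\ p ^+ 3 + c * p + d = 0.
Proof.
move=> r2 p0; rewrite quartic_comp => /quartic_inj[_ _ E2 E1 E0].
have bE : b = 0.
  apply: (mulIf p0); rewrite mul0r; move/eqP: E2; rewrite -subr_eq0 => /eqP E2.
  by transitivity (2%:R * (- 3%:R * p ^+ 2 - b * p) + 0); [rewrite -[X in _ + X]E2; ring | rewrite r2; ring].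
split=> //; apply: (mulIf p0); move/eqP: E0; rewrite -subr_eq0 => /eqP E0.
by rewrite mul0r -[RHS]E0 bE; ring.
Qed.

Lemma cubic_scale1 b c d e p : b != 0 ->
  quartic 0 b c d e \Po (1 *: 'X + p%:P) = quartic 0 b c d e -> 3%:R * p = 0.
Proof.
move=> b0; rewrite quartic_comp => /quartic_inj[_ _ E _ _]; apply: (mulIf b0).
by rewrite mul0r; move/eqP: E; rewrite -subr_eq0 => /eqP <-; ring.
Qed.

Lemma quartic_shift b c d e s p : s != 0 ->
    quartic 1 b c d e \Po (s *: 'X + p%:P) = s ^+ 4 *: quartic 1 b c d e ->
  4%:R * p = (s - 1) * b.
Proof.
move=> s0; rewrite quartic_comp scale_quartic => /quartic_inj[_ E3 _ _ _].
apply: (mulfI (expf_neq0 3 s0)); apply/eqP; rewrite -subr_eq0; apply/eqP.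
by move/eqP: E3; rewrite -subr_eq0 => /eqP <-; ring.
Qed.

Lemma cubic_translation_inv b g e p : 3%:R = 0 :> R -> p ^+ 3 = g ^+ 2 * p ->
  quartic 0 b 0 (- (g ^+ 2 * b)) e \Po (1 *: 'X + p%:P) = quartic 0 b 0 (- (g ^+ 2 * b)) e.
Proof.
move=> r3 E; rewrite quartic_comp !expr1n !mulr0 !mul0r r3 E.
by congr quartic; ring.
Qed.

Lemma quartic_translation_inv c d e p : 2%:R = 0 :> R -> p * (p ^+ 3 + c * p + d) = 0 ->
  quartic 1 0 c d e \Po (1 *: 'X + p%:P) = quartic 1 0 c d e.
Proof.
move=> r2 E; have r4 : 4%:R = 0 :> R by rewrite (natrM R 2 2) r2 mul0r.
have r6 : 6%:R = 0 :> R by rewrite (natrM R 2 3) r2 mul0r.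
rewrite quartic_comp !expr1n r2 r4 r6; congr quartic; try by ring.
by transitivity (p * (p ^+ 3 + c * p + d) + e); [ring | rewrite E add0r].
Qed.

(** Over an integral domain, distinct roots need not have invertible
differences, so the factorization is obtained from the symmetric functions:
subtracting the equations of the roots pairwise, and twice, gives their sum. *)
Lemma cubic_three_roots c d (x y z : R) : x != y -> x != z -> y != z ->
    x ^+ 3 + c * x + d = 0 -> y ^+ 3 + c * y + d = 0 -> z ^+ 3 + c * z + d = 0 ->
  'X^3 + c *: 'X + d%:P = ('X - x%:P) * ('X - y%:P) * ('X - z%:P).
Proof.
move=> xy xz yz Ex Ey Ez.
have quad u v : u != v -> u ^+ 3 + c * u + d = 0 -> v ^+ 3 + c * v + d = 0 ->
    u ^+ 2 + u * v + v ^+ 2 + c = 0.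
  move=> uv Eu Ev; apply: (@mulfI _ (u - v)); first by rewrite subr_eq0.
  by rewrite mulr0 -(subrr 0) -{1}Eu -Ev; ring.
have s0 : x + y + z = 0.
  apply: (@mulfI _ (y - z)); first by rewrite subr_eq0.
  by rewrite mulr0 -(subrr 0) -{1}(quad _ _ xy Ex Ey) -(quad _ _ xz Ex Ez); ring.
have zE : z = - (x + y) by apply/eqP; rewrite -addr_eq0 addrC s0.
have cE : c = - (x ^+ 2 + x * y + y ^+ 2).
  by apply/eqP; rewrite -addr_eq0 addrC (quad _ _ xy Ex Ey).
have dE : d = - (x ^+ 3 + c * x) by apply/eqP; rewrite -addr_eq0 addrC Ex.
rewrite dE cE zE -!mul_polyC !(polyCN, polyCD, polyCM, polyC_exp); ring.
Qed.

Lemma cubic_Vieta c d (x y z : R) :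
  'X^3 + c *: 'X + d%:P = ('X - x%:P) * ('X - y%:P) * ('X - z%:P) ->
  [/\ x + y + z = 0, c = x * y + x * z + y * z & d = - (x * y * z)].
Proof.
have -> : 'X^3 + c *: 'X + d%:P = quartic 0 1 0 c d.
  by rewrite quarticE !scale0r scale1r add0r addr0.
have -> : ('X - x%:P) * ('X - y%:P) * ('X - z%:P) =
    quartic 0 1 (- (x + y + z)) (x * y + x * z + y * z) (- (x * y * z)).
  rewrite quarticE -!mul_polyC !(polyCN, polyCD, polyCM); ring.
move=> /quartic_inj[_ _ /eqP E -> ->]; split=> //.
by apply/eqP; rewrite -oppr_eq0 eq_sym.
Qed.

End Equations.

(** * Two families of symmetries *)

(** The polynomial ['X^d - 1] is separable, so it has [d] roots, and a finite
group of roots of unity of that order contains a primitive one. *)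
Lemma closed_prim_root (k : closedFieldType) d : d%:R != 0 :> k ->
  exists w : k, d.-primitive_root w.
Proof.
move=> d0; have d_gt0 : (0 < d)%N by rewrite lt0n; apply: contraNneq d0 => ->.
have [rs E] := closed_field_poly_normal ('X^d - 1 : {poly k}).
have := lead_coefXnsubC (1 : k) d_gt0; rewrite -/(1%:P) => l1.
rewrite l1 scale1r in E.
have Urs : uniq rs by rewrite -separable_prod_XsubC -E cyclotomic.separable_Xn_sub_1.
have : has d.-primitive_root rs.
  apply: has_prim_root => //.
    apply/allP => r rR; have : root ('X^d - 1) r by rewrite E root_prod_XsubC.
    by [].
  by have := size_prod_XsubC rs id; rewrite -E size_XnsubC // => -[->].
by case/hasP => w _ pw; exists w.
Qed.

(** A root would split a linear factor off the equation. *)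
Lemma irreducible_no_root (k : fieldType) n (X : hypersurface k n.+2)
    (f : {poly {mpoly k[n.+1]}}) :
  defining_form X = from_poly f -> (2 < size f)%N -> forall q, ~~ root f q.
Proof.
move=> fX f2 q; apply/negP => /factor_theorem[r fE].
have unit_size (u : {poly {mpoly k[n.+1]}}) : from_poly u \is a GRing.unit -> size u = 1%N.
  case/unitrPr => v /(congr1 (@to_poly k n)).
  rewrite (rmorphM (@to_poly k n)) (rmorph1 (@to_poly k n)) /= from_polyK => uv.
  have : u \is a GRing.unit by apply/unitrPr; exists (to_poly v).
  by rewrite poly_unitE => /andP[/eqP].
have r0 : r != 0 by apply: contraTneq f2 => r0; rewrite fE r0 mul0r size_poly0.
move: f2; rewrite fE size_mul ?polyXsubC_eq0 // size_XsubC addn2 /= => r1.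
have [_ /(_ (from_poly r) (from_poly ('X - q%:P)))] := form_irreducible X.
rewrite fX fE rmorphM => /(_ erefl)[/unit_size sr|/unit_size]; first by rewrite sr in r1.
by rewrite size_XsubC.
Qed.

Section Families.
Variables (k : closedFieldType) (n : nat) (X : hypersurface k n.+2).
Variables (f : {poly {mpoly k[n.+1]}}) (D e : nat).
Local Notation FX := (defining_form X).
Hypotheses (fX : FX = from_poly f) (homF : FX \is D.-homog) (D2 : (2 < D)%N).
Hypotheses (homl : lead_coef f \is e.-homog) (f_size : (2 < size f)%N).

(** The symmetries are the homotheties about [- M] whose ratios are the [d+2]-th
roots of unity. *)
Lemma homothety_extendable d (C M H : {mpoly k[n.+1]}) :
    f = C%:P * ('X + M%:P) ^+ d.+2 + H%:P -> size f = d.+3 -> M \is 1.-homog ->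
    d.+2%:R != 0 :> k ->
  extendable_galois_point X /\ galois_group_isom (projection_field X) 'I_d.+2.
Proof.
move=> fE szf hM /closed_prim_root[w pw].
have w0 : w != 0.
  by apply: contra_eq_neq (prim_expr_order pw) => ->; rewrite expr0n eq_sym oner_eq0.
have wM (a b : 'I_d.+2) : w ^+ (a * b)%g = w ^+ a * w ^+ b.
  by rewrite FinRing.zmodMgE /= (prim_expr_mod pw) exprD.
apply: (affine_family_extendable fX homl f_size (alpha := fun a : 'I_d.+2 => w ^+ a)
  (beta := fun a => (w ^+ a - 1) *: M)).
- by move=> a; rewrite expf_neq0.
- by move=> a; rewrite rpredZ.
- move=> a b [/eqP]; rewrite (eq_prim_root_expr pw) !modn_small // => /eqP E _.
  exact: val_inj.
- exact: wM.
- by move=> a b; rewrite wM scalerA -scalerDl; congr (_ *: _); ring.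
- move=> a; set q := affine_poly _ _.
  have qE : ('X + M%:P) \Po q = (w ^+ a)%:MP *: ('X + M%:P).
    rewrite comp_polyD comp_polyX comp_polyC /q /affine_poly scalerDr -addrA -polyCD.
    congr (_ + _); rewrite -mul_polyC -polyCM mul_mpolyC; congr (_%:P).
    by rewrite scalerBl scale1r subrK.
  rewrite fE comp_polyD comp_polyM !comp_polyC rmorphXn /= qE exprZn -rmorphXn /=.
  by rewrite exprAC (prim_expr_order pw) expr1n mpolyC1 scale1r.
- by rewrite card_ord.
Qed.

Lemma translation_extendable (gT : finGroupType) (beta : gT -> {mpoly k[n.+1]}) :
    (forall a, beta a \is 1.-homog) -> (forall a, beta a = 0 -> a = 1%g) ->
    (forall a b, beta (a * b)%g = beta a + beta b) ->
    (forall a, f \Po affine_poly 1 (beta a) = f) -> size f = #|gT|.+1 ->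
  extendable_galois_point X /\ galois_group_isom (projection_field X) gT.
Proof.
move=> hbeta ker betaM fab szf.
have inj : injective beta.
  move=> a b E; apply/eqP; rewrite eq_mulgV1; apply/eqP/ker.
  by apply: (addIr (beta b)); rewrite -betaM mulgKV E add0r.
apply: (affine_family_extendable fX homl f_size (alpha := fun=> 1) (beta := beta)) => //.
- by move=> a; rewrite oner_neq0.
- by move=> a b [/inj].
- by move=> a b; rewrite mulr1.
- by move=> a b; rewrite betaM scale1r.
Qed.

(** There are at least two affine symmetries, and the identity is only one of
them. *)
Lemma nontrivial_affine_map : (1 <= n)%N -> extendable_galois_point X ->
  exists a p, [/\ a != 0, p \is 1.-homog, a = 1 -> p != 0 &
      f \Po affine_poly a p = (a ^+ (size f).-1)%:MP *: f].
Proof.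
move=> n1 ext; have [S [US sS SP]] := extendable_affine_maps fX homF D2 homl f_size n1 ext.
have [ap apS nap] : exists2 ap, ap \in S & ap != (1, 0).
  have : (1 < size S)%N by rewrite sS -ltnS prednK // ltnW // ltnW.
  case: (S) US => [|x [|y s]] //=; rewrite inE negb_or => /andP[/andP[xy _] _] _.
  have [xE|] := eqVneq x (1, 0); last by exists x; rewrite ?mem_head.
  by exists y; rewrite ?inE ?eqxx ?orbT // -xE eq_sym.
have [a0 hp E] := SP _ apS; move: ap {apS} nap a0 hp E => [a p] /= nap a0 hp E.
exists a, p; split=> // a1; apply: contra nap => /eqP p0.
by rewrite a1 p0.
Qed.

End Families.

Section Sizes.
Variable R : idomainType.
Implicit Types a b c d e : R.

Lemma quartic_lead a b c d e : a != 0 ->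
  size (quartic a b c d e) = 5 /\ lead_coef (quartic a b c d e) = a.
Proof. by move=> a0; rewrite lead_coefE /quartic (@PolyK _ 0). Qed.

Lemma cubic_lead b c d e : b != 0 ->
  size (quartic 0 b c d e) = 4 /\ lead_coef (quartic 0 b c d e) = b.
Proof.
move=> b0; have -> : quartic 0 b c d e = Poly [:: e; d; c; b].
  apply/polyP => i; rewrite !coef_Poly.
  by case: i => [|[|[|[|[|i]]]]] //=; rewrite !nth_nil.
by rewrite lead_coefE (@PolyK _ 0).
Qed.

End Sizes.

(** * The inner and the outer case *)

Section Characteristic.
Variables (k : fieldType) (n : nat).

Lemma mpoly_natr_eq0 m : (m%:R == 0 :> {mpoly k[n]}) = (m%:R == 0 :> k).
Proof. by rewrite -(rmorph_nat (@mpolyC n k)) mpolyC_eq0. Qed.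

Lemma mpolyC_eq1 (a : k) : (a%:MP_[n] == 1) = (a == 1).
Proof. by rewrite -[1]mpolyC1 -subr_eq0 -mpolyCB mpolyC_eq0 subr_eq0. Qed.

(** Multiples of a form depend only on the residue of the multiplier modulo the
characteristic, which makes translations by such multiples a cyclic group. *)
Lemma mulrn_modn (p : {mpoly k[n]}) d m : d%:R = 0 :> k -> p *+ (m %% d) = p *+ m.
Proof.
move=> d0; rewrite [in RHS](divn_eq m d) mulrnDr mulrnA -[_ *+ d]mulr_natl.
suff -> : d%:R = 0 :> {mpoly k[n]} by rewrite mul0r add0r.
by apply/eqP; rewrite mpoly_natr_eq0 d0.
Qed.

End Characteristic.

Section Cubic.
Variables (k : closedFieldType) (n : nat) (X : hypersurface k n.+2).
Variables b c d e : {mpoly k[n.+1]}.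
Let f := quartic 0 b c d e.
Hypotheses (fX : defining_form X = from_poly f) (homF : defining_form X \is 4.-homog).
Hypotheses (hb : b \is 1.-homog) (b0 : b != 0).

Let szf : size f = 4. Proof. by case: (cubic_lead c d e b0). Qed.
Let homl : lead_coef f \is 1.-homog. Proof. by case: (cubic_lead c d e b0) => _ ->. Qed.
Let f2 : (2 < size f)%N. Proof. by rewrite szf. Qed.
Let nroot := irreducible_no_root fX f2.

Lemma cubic_affine_map : (1 <= n)%N -> extendable_galois_point X ->
  exists a p, [/\ p \is 1.-homog, a = 1 -> p != 0,
    f \Po (a%:MP *: 'X + p%:P) = (a ^+ 3)%:MP *: f &
    a != 1 -> [/\ a ^+ 3 = 1, c = 3%:R * b * ((a - 1)^-1 *: p) &
                  d = 3%:R * b * ((a - 1)^-1 *: p) ^+ 2]].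
Proof.
move=> n1 ext.
have [a [p [a0 hp ap]]] := nontrivial_affine_map fX homF (isT : (2 < 4)%N) homl f2 n1 ext.
rewrite szf /= /affine_poly => E; exists a, p; split=> // a1.
have pE : p = (a%:MP - 1) * ((a - 1)^-1 *: p).
  by rewrite -mpolyC1 -mpolyCB mul_mpolyC scalerA mulfV ?scale1r // subr_eq0.
have [| | |s3 cE dE] := cubic_homothety b0 _ _ pE nroot.
- by rewrite mpolyC_eq0.
- by rewrite mpolyC_eq1.
- by rewrite [LHS]E rmorphXn.
by split=> //; apply/eqP; rewrite -(mpolyC_eq1 n.+1) (rmorphXn (@mpolyC n.+1 k)) /= s3.
Qed.
(** In characteristic 3 the only cube root of unity is 1, so the nontrivial
symmetry is a translation. *)
Lemma cubic_wild_necessary : 3%:R = 0 :> k -> (1 <= n)%N -> extendable_galois_point X ->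
  c = 0 /\ exists G, [/\ G \is 1.-homog, G != 0 & d = - (G ^+ 2 * b)].
Proof.
move=> k3 n1 /(cubic_affine_map n1)[a [p [hp p0 E ne1]]].
have r3 : 3%:R = 0 :> {mpoly k[n.+1]} by apply/eqP; rewrite mpoly_natr_eq0 k3.
have a1 : a = 1.
  apply/eqP; apply: contraT => a1; have [a3 _ _] := ne1 a1.
  (* In characteristic 3, cubing is additive. *)
  have : (a - 1) ^+ 3 = a ^+ 3 - 1 - 3%:R * (a ^+ 2 - a) by ring.
  by rewrite a3 k3 mul0r subrr subr0 => /eqP; rewrite expf_eq0 subr_eq0 (negPf a1).
move: E; rewrite a1 expr1n mpolyC1 [RHS]scale1r => {}E.
have [-> ->] := cubic_translation r3 (p0 a1) E.
by split=> //; exists p; split=> //; apply: p0.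
Qed.

(** If 3 is invertible, there are no nontrivial translations, so the nontrivial
symmetry is a homothety. *)
Lemma cubic_tame_necessary : 3%:R != 0 :> k -> (1 <= n)%N -> extendable_galois_point X ->
  3%:R * b * d - c ^+ 2 = 0.
Proof.
move=> k3 n1 /(cubic_affine_map n1)[a [p [hp p0 E ne1]]].
have r3 : 3%:R != 0 :> {mpoly k[n.+1]} by rewrite mpoly_natr_eq0.
have a1 : a != 1.
  apply/negP => /eqP a1; move: E; rewrite a1 expr1n mpolyC1 [RHS]scale1r => {}E.
  by have /eqP := cubic_scale1 b0 E; rewrite mulf_eq0 (negPf r3) (negPf (p0 a1)).
by have [_ -> ->] := ne1 a1; ring.
Qed.

Lemma cubic_wild_sufficient G : 3%:R = 0 :> k -> c = 0 -> G \is 1.-homog -> G != 0 ->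
    d = - (G ^+ 2 * b) ->
  extendable_galois_point X /\ galois_group_isom (projection_field X) 'I_3.
Proof.
move=> k3 c0 hG G0 dE.
have r3 : 3%:R = 0 :> {mpoly k[n.+1]} by apply/eqP; rewrite mpoly_natr_eq0 k3.
apply: (translation_extendable fX homl f2 (beta := fun a : 'I_3 => G *+ a)).
- by move=> a; rewrite rpredMn.
- case=> [[|[|[|//]]] lt3] /=; first by move=> _; apply: val_inj.
    by rewrite mulr1n => /eqP; rewrite (negPf G0).
  move=> G2; case/eqP: G0; rewrite -[LHS](addrK (G *+ 2)) -mulrS G2 subr0 -mulr_natl.
  by rewrite r3 mul0r.
- by move=> x y; rewrite FinRing.zmodMgE /= mulrn_modn // mulrnDr.
- move=> x; rewrite /affine_poly mpolyC1 /f c0 dE; apply: cubic_translation_inv => //.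
  case: x => [[|[|[|//]]] lt3] /=; rewrite ?mulr0n ?mulr1n ?mulr0 ?expr0n //.
    by rewrite -exprSr.
  by apply/eqP; rewrite -subr_eq0; apply/eqP; transitivity (3%:R * (G ^+ 3 *+ 2)); [ring|rewrite r3 mul0r].
- by rewrite szf card_ord.
Qed.

(** Since the linear form [b] is prime and divides [c^2], it divides [c], which
gives the center of the homotheties. *)
Lemma cubic_tame_sufficient : 3%:R != 0 :> k -> c \is 2.-homog -> 3%:R * b * d - c ^+ 2 = 0 ->
  extendable_galois_point X /\ galois_group_isom (projection_field X) 'I_3.
Proof.
move=> k3 hc /eqP; rewrite subr_eq0 => /eqP E.
have r3 : 3%:R != 0 :> {mpoly k[n.+1]} by rewrite mpoly_natr_eq0.
have [r cr] : divides b c.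
  have [_ _ /(_ c c)] := linear_form_prime hb b0.
  by case=> //; exists (3%:R * d); rewrite -expr2 -E; ring.
have [N hN cE] := @dhomog_factor _ _ b c r 1 1 hb hc cr.
pose M := 3%:R^-1 *: N; have NE : N = 3%:R * M.
  by rewrite -(rmorph_nat (@mpolyC n.+1 k)) mul_mpolyC scalerA mulfV // scale1r.
have dE : d = 3%:R * M ^+ 2 * b.
  by apply: (mulfI b0); apply: (mulfI r3); rewrite mulrA E cE NE; ring.
have fE : f = b%:P * ('X + M%:P) ^+ 3 + (e - b * M ^+ 3)%:P.
  rewrite /f quarticE cE NE dE -!mul_polyC.
  by rewrite !(polyCN, polyCD, polyCM, polyC_exp, polyC_natr); ring.
apply: (homothety_extendable fX homl f2 fE) => //.
by rewrite rpredZ.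
Qed.

End Cubic.

Lemma klein_four_dprod : exists C1 C2 : {group 'I_2 * 'I_2},
  [/\ (C1 \x C2)%g = [set: 'I_2 * 'I_2], cyclic C1 /\ #|C1| = 2 & cyclic C2 /\ #|C2| = 2].
Proof.
have cyc2 (C : {group 'I_2 * 'I_2}) : #|C| = 2 -> cyclic C /\ #|C| = 2.
  by move=> C2; rewrite prime_cyclic C2.
exists (setX_group [set: 'I_2]%G 1%G), (setX_group 1%G [set: 'I_2]%G); split.
- by rewrite [LHS]setX_dprod; apply/setP => x; rewrite !inE.
- by apply: cyc2; rewrite /= cardsX cardsT card_ord cards1.
- by apply: cyc2; rewrite /= cardsX cardsT card_ord cards1.
Qed.

Section Quartic.
Variables (k : closedFieldType) (n : nat) (X : hypersurface k n.+2).
Variables b c d e : {mpoly k[n.+1]}.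
Let f := quartic 1 b c d e.
Hypotheses (fX : defining_form X = from_poly f) (homF : defining_form X \is 4.-homog).
Hypotheses (hb : b \is 1.-homog).

Let szf : size f = 5. Proof. by case: (quartic_lead b c d e (oner_neq0 _)). Qed.
Let homl : lead_coef f \is 0.-homog.
Proof. by case: (quartic_lead b c d e (oner_neq0 _)) => _ ->; apply: dhomog1. Qed.
Let f2 : (2 < size f)%N. Proof. by rewrite szf. Qed.
Let nroot := irreducible_no_root fX f2.

Lemma quartic_affine_maps : (1 <= n)%N -> extendable_galois_point X ->
  exists2 S : seq (k * {mpoly k[n.+1]}), uniq S /\ size S = 4 &
    forall ap, ap \in S -> [/\ ap.1 != 0, ap.2 \is 1.-homog &
      f \Po (ap.1%:MP *: 'X + ap.2%:P) = ap.1%:MP ^+ 4 *: f].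
Proof.
move=> n1 ext.
have [S [US sS SP]] := extendable_affine_maps fX homF (isT : (2 < 4)%N) homl f2 n1 ext.
exists S; first by rewrite sS szf.
move=> [a p] /SP[/= a0 hp E]; split=> //; rewrite -(rmorphXn (@mpolyC n.+1 k)) /=.
by move: E; rewrite szf.
Qed.

(** In characteristic 2 the only fourth root of unity is 1, so the four
symmetries are translations. The three nonzero ones are roots of the cubic. *)
Lemma quartic_wild_necessary : 2%:R = 0 :> k -> (1 <= n)%N -> extendable_galois_point X ->
  b = 0 /\ exists B1 B2 B3 : {mpoly k[n.+1]},
    [/\ [/\ B1 \is 1.-homog, B2 \is 1.-homog & B3 \is 1.-homog],
        [/\ B1 != 0, B2 != 0 & B3 != 0] &
        'X^3 + c *: 'X + d%:P = ('X - B1%:P) * ('X - B2%:P) * ('X - B3%:P)].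
Proof.
move=> k2 n1 /(quartic_affine_maps n1)[S [US sS] SP].
have r2 : 2%:R = 0 :> {mpoly k[n.+1]} by apply/eqP; rewrite mpoly_natr_eq0 k2.
have S1 ap : ap \in S -> ap.1 = 1.
  case: ap => a p /SP[/= a0 hp E]; apply/eqP; apply: contraT => a1.
  have pE : p = (a%:MP - 1) * ((a - 1)^-1 *: p).
    by rewrite -mpolyC1 -mpolyCB mul_mpolyC scalerA mulfV ?scale1r // subr_eq0.
  have [| |s4 _ _ _] := quartic_homothety _ _ pE nroot E.
  - by rewrite mpolyC_eq0.
  - by rewrite mpolyC_eq1.
  (* In characteristic 2, taking fourth powers is additive. *)
  have : (a%:MP - 1 : {mpoly k[n.+1]}) ^+ 4 =
      a%:MP ^+ 4 - 1 + 2%:R * (1 - 2%:R * a%:MP ^+ 3 + 3%:R * a%:MP ^+ 2 - 2%:R * a%:MP) by ring.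
  by rewrite s4 r2 !mul0r subrr addr0 => /eqP; rewrite expf_eq0 subr_eq0 mpolyC_eq1 (negPf a1).
have UT : uniq (map snd S).
  rewrite map_inj_in_uniq // => -[a p] [a' p'] /S1/= -> /S1/= -> /= -> //.
have TP p : p \in map snd S -> p != 0 -> [/\ p \is 1.-homog, b = 0 & p ^+ 3 + c * p + d = 0].
  case/mapP => -[a q] aqS /= -> q0; have := S1 _ aqS => /= a1.
  have [_ /= hq] := SP _ aqS; rewrite a1 mpolyC1 expr1n [RHS]scale1r => E.
  by have [] := quartic_translation r2 q0 E.
have sT : size (map snd S) = 4 by rewrite size_map.
pose T := rem 0 (map snd S).
have : (2 < size T)%N.
  have [S0|/rem_id TE] := boolP (0 \in map snd S); first by rewrite /T size_rem ?sT.
  by rewrite /T TE sT.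
have : uniq T by apply: rem_uniq.
have : forall p, p \in T -> p != 0 /\ [/\ p \is 1.-homog, b = 0 & p ^+ 3 + c * p + d = 0].
  by move=> p; rewrite mem_rem_uniq // => /andP[p0 pS]; split=> //; apply: TP.
case: T => [|x [|y [|z T]]] // TE /= /andP[xT /andP[yT _]] _.
have [x0 [hx bE Ex]] := TE x (mem_head _ _).
have [|y0 [hy _ Ey]] := TE y; first by rewrite !inE eqxx orbT.
have [|z0 [hz _ Ez]] := TE z; first by rewrite !inE eqxx !orbT.
move: xT yT; rewrite !inE !negb_or => /andP[xy /andP[xz _]] /andP[yz _].
split=> //; exists x, y, z; split=> //.
exact: cubic_three_roots.
Qed.

(** The center [- m] of the homotheties is determined by [b], so the four
symmetries have four different ratios. They cannot all be square roots of 1,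
which kills the quadratic term. *)
Lemma quartic_tame_necessary : 2%:R != 0 :> k -> (1 <= n)%N -> extendable_galois_point X ->
  3%:R * b ^+ 2 - 8%:R * c = 0 /\ b ^+ 3 - 16%:R * d = 0.
Proof.
move=> k2 n1 /(quartic_affine_maps n1)[S [US sS] SP].
have k4 : 4%:R != 0 :> k by rewrite (natrM k 2 2) mulf_neq0.
pose m : {mpoly k[n.+1]} := 4%:R^-1 *: b.
have bE : b = 4%:R * m.
  by rewrite -(rmorph_nat (@mpolyC n.+1 k)) mul_mpolyC scalerA mulfV // scale1r.
have r4 : 4%:R != 0 :> {mpoly k[n.+1]} by rewrite mpoly_natr_eq0.
have pE ap : ap \in S -> ap.2 = (ap.1%:MP - 1) * m.
  case: ap => a p /SP[/= a0 hp E]; apply: (mulfI r4).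
  by rewrite (quartic_shift _ E) ?mpolyC_eq0 // bE; ring.
have U1 : uniq (map fst S).
  rewrite map_inj_in_uniq // => -[a p] [a' p'] /pE/= -> /pE/= -> /= -> //.
have s1 : size (map fst S) = 4 by rewrite size_map.
have AP a : a \in map fst S -> a != 1 ->
    (c - 6%:R * m ^+ 2) * (a%:MP ^+ 2 - 1) = 0 /\
    d = 4%:R * m ^+ 3 + 2%:R * (c - 6%:R * m ^+ 2) * m.
  case/mapP => -[a' p] apS /= -> a1; have [/= a0 hp E] := SP _ apS.
  have [| |_ _ cE dE] := quartic_homothety _ _ (pE _ apS) nroot E.
  - by rewrite mpolyC_eq0.
  - by rewrite mpolyC_eq1.
  - by split.
have cE : c - 6%:R * m ^+ 2 = 0.
  apply/eqP; apply: contraT => h0.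
  (* Otherwise the four ratios would be roots of 'X^2 - 1. *)
  have := @max_poly_roots _ ('X^2 - 1 : {poly k}) (map fst S) _ _ U1.
  rewrite s1 size_XnsubC // -size_poly_gt0 size_XnsubC // => /(_ isT); apply.
  apply/allP => a /AP aP; rewrite rootE !hornerE -?expr2.
  have [->|/aP[/eqP + _]] := eqVneq a 1; first by rewrite expr1n subrr.
  rewrite mulf_eq0 (negPf h0) -mpolyC1 -(rmorphXn (@mpolyC n.+1 k)) /=.
  by rewrite -mpolyCB mpolyC_eq0.
have [a aS a1] : exists2 a, a \in map fst S & a != 1.
  case: (map fst S) U1 s1 => [|x [|y s]] //=; rewrite inE negb_or => /andP[/andP[xy _] _] _.
  have [xE|] := eqVneq x 1; last by exists x; rewrite ?mem_head.
  by exists y; rewrite ?inE ?eqxx ?orbT // -xE eq_sym.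
have [_ dE] := AP a aS a1; rewrite dE cE bE.
have -> : c = 6%:R * m ^+ 2 by apply/eqP; rewrite -subr_eq0 cE.
by split; ring.
Qed.

(** In characteristic 2 the relation [B1 + B2 + B3 = 0] says that 0 and the
three roots form a group of type (2, 2) under addition. *)
Lemma quartic_wild_sufficient B1 B2 B3 : 2%:R = 0 :> k -> b = 0 ->
    B1 \is 1.-homog -> B2 \is 1.-homog -> B1 != 0 -> B2 != 0 -> B3 != 0 ->
    'X^3 + c *: 'X + d%:P = ('X - B1%:P) * ('X - B2%:P) * ('X - B3%:P) ->
  extendable_galois_point X /\ galois_group_isom (projection_field X) ('I_2 * 'I_2)%type.
Proof.
move=> k2 b0 h1 h2 B10 B20 B30 E; have [s0 cE dE] := cubic_Vieta E.
have r2 : 2%:R = 0 :> {mpoly k[n.+1]} by apply/eqP; rewrite mpoly_natr_eq0 k2.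
have B12 : B1 + B2 = - B3 by apply/eqP; rewrite -addr_eq0 s0.
apply: (translation_extendable fX homl f2 (beta := fun a : 'I_2 * 'I_2 => B1 *+ a.1 + B2 *+ a.2)).
- by move=> a; rewrite rpredD ?rpredMn.
- case=> -[[|[|//]] lt1] [[|[|//]] lt2] /=; rewrite ?mulr1n ?mulr0n ?add0r ?addr0 ?B12.
  + by move=> _; congr (_, _); apply: val_inj.
  + by move/eqP; rewrite (negPf B20).
  + by move/eqP; rewrite (negPf B10).
  + by move/eqP; rewrite oppr_eq0 (negPf B30).
- move=> x y /=; rewrite !mulrn_modn // !mulrnDr.
  by rewrite addrACA.
- move=> x; rewrite /affine_poly mpolyC1 /f b0; apply: quartic_translation_inv => //.
  rewrite cE dE; case: x => -[[|[|//]] lt1] [[|[|//]] lt2] /=; rewrite ?mulr1n ?mulr0n ?add0r ?addr0.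
  + by rewrite mul0r.
  + have -> : B1 = - B2 - B3 by rewrite -[LHS](addrK B2) B12 addrC.
    by ring.
  + have -> : B2 = - B1 - B3 by rewrite -[LHS](addrK B1) [B2 + _]addrC B12 addrC.
    by ring.
  + have -> : B1 + B2 = B3 + 2%:R * (- B3) by rewrite B12; ring.
    rewrite r2 mul0r addr0; have -> : B3 = - B1 - B2 by rewrite -opprD B12 opprK.
    by ring.
- by rewrite szf card_prod !card_ord.
Qed.

(** The two equations say that the quadratic and linear terms vanish in the
variable ['X + m] with [4 m = b]. *)
Lemma quartic_tame_sufficient : 2%:R != 0 :> k ->
    3%:R * b ^+ 2 - 8%:R * c = 0 -> b ^+ 3 - 16%:R * d = 0 ->
  extendable_galois_point X /\ galois_group_isom (projection_field X) 'I_4.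
Proof.
move=> k2 /eqP + /eqP; rewrite !subr_eq0 => /eqP Ec /eqP Ed.
have k4 : 4%:R != 0 :> k by rewrite (natrM k 2 2) mulf_neq0.
have r2 : 2%:R != 0 :> {mpoly k[n.+1]} by rewrite mpoly_natr_eq0.
pose m : {mpoly k[n.+1]} := 4%:R^-1 *: b.
have bE : b = 4%:R * m.
  by rewrite -(rmorph_nat (@mpolyC n.+1 k)) mul_mpolyC scalerA mulfV // scale1r.
have cE : c = 6%:R * m ^+ 2.
  apply: (mulfI (expf_neq0 3 r2)); transitivity (8%:R * c); first by ring.
  by rewrite -Ec bE; ring.
have dE : d = 4%:R * m ^+ 3.
  apply: (mulfI (expf_neq0 4 r2)); transitivity (16%:R * d); first by ring.
  by rewrite -Ed bE; ring.
have fE : f = 1%:P * ('X + m%:P) ^+ 4 + (e - m ^+ 4)%:P.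
  rewrite /f quarticE bE cE dE -!mul_polyC.
  by rewrite !(polyCN, polyCD, polyCM, polyC_exp, polyC_natr); ring.
apply: (homothety_extendable fX homl f2 fE) => //.
by rewrite rpredZ.
Qed.

End Quartic.

(** * The characterization *)

Section Equation.
Variables (k : closedFieldType) (n : nat) (X : hypersurface k n.+2) (F : nat -> {mpoly k[n.+1]}).
Hypothesis homogF : forall i, (i <= 4)%N -> F i \is i.-homog.
Hypothesis formX : defining_form X = \sum_(i < 5) lift_form (F i) * 'X_ord0 ^+ (4 - i).
Local Notation f := (quartic (F 0) (F 1) (F 2) (F 3) (F 4)).
Local Notation center := (fun i : 'I_n.+2 => proj_center k n i 0).

Lemma equation_from_poly : defining_form X = from_poly f.
Proof.
rewrite formX quarticE -!mul_polyC !big_ord_recl big_ord0 addr0.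
rewrite !(rmorphD (@from_poly k n)) !(rmorphM (@from_poly k n)) /= !from_polyC !from_polyX.
by rewrite !exprS expr0 !mulr1 !addrA.
Qed.

Lemma equation_homog : defining_form X \is 4.-homog.
Proof.
rewrite equation_from_poly; apply: from_poly_homog => [|i _].
  by rewrite /quartic (leq_trans (size_Poly _)).
rewrite /quartic coef_Poly.
by case: i => [|[|[|[|[|i]]]]] /=; rewrite ?nth_nil ?dhomog0 ?homogF.
Qed.

(** The value of the equation at the center is the constant [F 0]. *)
Lemma center_on_leading : on_hypersurface X (proj_center k n) -> F 0 = 0.
Proof.
have F0C : F 0 = ((F 0)@_0)%:MP.
  apply: msize1_polyC; have [->|F00] := eqVneq (F 0) 0; first by rewrite msize0.
  by rewrite (dhomog_msizeE F00 (homogF _)).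
rewrite /on_hypersurface formX (raddf_sum (meval center)) big_ord_recl big1 => [|i _] /=.
  rewrite addr0 mevalM meval_lift_center F0C mevalC rmorphXn /= mevalXU center_ord0.
  by rewrite expr1n mulr1 => ->.
have i4 : (i.+1 <= 4)%N by case: i.
by rewrite mevalM meval_lift_center (meval0_homog (homogF i4)) ?mul0r.
Qed.

(** When [F 0 = 0], the form [F 1] is the equation of the tangent space at the
center, since the other terms vanish there to order at least 2. *)
Lemma smooth_center_tangent : F 0 = 0 -> smooth_at X (proj_center k n) -> F 1 != 0.
Proof.
move=> F00 [i]; apply: contra_neq => F10.
have der j l : (1 < j <= 4)%N -> (lift_form (F j) * 'X_ord0 ^+ l)^`M(i).@[center] = 0.
  case/andP => j1 j4; rewrite mderivM mevalD !mevalM.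
  rewrite (mderiv_lift_center i (homogF j4) j1) meval_lift_center.
  by rewrite (meval0_homog (homogF j4) (ltnW j1)) !mul0r addr0.
rewrite formX (raddf_sum (mderiv i)) (raddf_sum (meval center)) big1 // => -[j jlt] _ /=.
case: j jlt => [|[|j]] jlt; first by rewrite F00 rmorph0 mul0r mderiv0 meval0.
  by rewrite F10 rmorph0 mul0r mderiv0 meval0.
exact: der.
Qed.

End Equation.

Theorem theorem1p4 (k : closedFieldType) (n : nat) (hn : (1 <= n)%N)
    (X : hypersurface k n.+2) (F : nat -> {mpoly k[n.+1]})
    (homogF : forall i, (i <= 4)%N -> F i \is i.-homog)
    (formX : defining_form X = \sum_(i < 5) lift_form (F i) * 'X_ord0 ^+ (4 - i)) :
  (on_hypersurface X (proj_center k n) -> smooth_at X (proj_center k n) ->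
    [/\ 3%N \in [pchar k] ->
          (extendable_galois_point X <->
           F 2%N = 0 /\
           exists G : {mpoly k[n.+1]},
             [/\ G \is 1.-homog, G != 0 & F 3%N = - (G ^+ 2 * F 1%N)]),
        3%N \notin [pchar k] ->
          (extendable_galois_point X <->
           3%:R * F 1%N * F 3%N - F 2%N ^+ 2 = 0)
      & extendable_galois_point X ->
          exists gT : finGroupType,
            [/\ galois_group_isom (projection_field X) gT,
                cyclic [set: gT] & #|[set: gT]| = 3%N]])
  /\
  (~ on_hypersurface X (proj_center k n) -> F 0%N = 1 ->
    (2%N \in [pchar k] ->
       (extendable_galois_point X <->
        F 1%N = 0 /\
        exists B1 B2 B3 : {mpoly k[n.+1]},
          [/\ [/\ B1 \is homog mdeg, B2 \is homog mdeg & B3 \is homog mdeg],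
              [/\ B1 != 0, B2 != 0 & B3 != 0]
            & 'X^3 + F 2%N *: 'X + (F 3%N)%:P =
              ('X - B1%:P) * ('X - B2%:P) * ('X - B3%:P)]) /\
       (extendable_galois_point X ->
          exists gT : finGroupType,
            galois_group_isom (projection_field X) gT /\
            exists C1 C2 : {group gT},
              [/\ (C1 \x C2)%g = [set: gT],
                  cyclic C1 /\ #|C1| = 2%N & cyclic C2 /\ #|C2| = 2%N])) /\
    (2%N \notin [pchar k] ->
       (extendable_galois_point X <->
        3%:R * F 1%N ^+ 2 - 8%:R * F 2%N = 0 /\
        F 1%N ^+ 3 - 16%:R * F 3%N = 0) /\
       (extendable_galois_point X ->
          exists gT : finGroupType,
            [/\ galois_group_isom (projection_field X) gT,
                cyclic [set: gT] & #|[set: gT]| = 4%N]))).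
Proof.
have fX := equation_from_poly formX; have homX := equation_homog homogF formX.
have charP p : prime p -> p \notin [pchar k] -> p%:R != 0 :> k.
  by move=> pp; apply: contra => /eqP p0; rewrite inE /= pp p0 eqxx.
have cyc d : cyclic [set: 'I_d.+1] /\ #|[set: 'I_d.+1]| = d.+1.
  by rewrite cardsT card_ord Zp_cycle cycle_cyclic.
split=> [onX smX | _ F01].
  have F00 := center_on_leading homogF formX onX.
  have F10 := smooth_center_tangent homogF formX F00 smX.
  rewrite F00 in fX; have h1 := homogF 1 isT.
  have wild : 3%N \in [pchar k] -> extendable_galois_point X <-> F 2 = 0 /\
      exists G, [/\ G \is 1.-homog, G != 0 & F 3 = - (G ^+ 2 * F 1)].
    move/pcharf0 => k3; split; first exact: (cubic_wild_necessary fX homX).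
    by case=> F20 [G [hG G0 F3]]; case: (cubic_wild_sufficient fX h1 F10 k3 F20 hG G0 F3).
  have tame : 3%N \notin [pchar k] -> extendable_galois_point X <->
      3%:R * F 1 * F 3 - F 2 ^+ 2 = 0.
    move/(charP 3 isT) => k3; split; first exact: (cubic_tame_necessary fX homX).
    by move/(cubic_tame_sufficient fX h1 F10 k3 (homogF 2 isT)) => [].
  split=> // ext; exists 'I_3; have [? ?] := cyc 2; split=> //.
  have [c3|c3] := boolP (3%N \in [pchar k]).
    have [F20 [G [hG G0 F3]]] := (wild c3).1 ext.
    by case: (cubic_wild_sufficient fX h1 F10 (pcharf0 c3) F20 hG G0 F3).
  by case: (cubic_tame_sufficient fX h1 F10 (charP 3 isT c3) (homogF 2 isT) ((tame c3).1 ext)).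
rewrite F01 in fX.
split=> [/pcharf0 k2 | /(charP 2 isT) k2].
  have nec := quartic_wild_necessary fX homX k2 hn.
  have suf : (F 1 = 0 /\
      exists B1 B2 B3 : {mpoly k[n.+1]},
        [/\ [/\ B1 \is homog mdeg, B2 \is homog mdeg & B3 \is homog mdeg],
            [/\ B1 != 0, B2 != 0 & B3 != 0]
          & 'X^3 + F 2%N *: 'X + (F 3%N)%:P = ('X - B1%:P) * ('X - B2%:P) * ('X - B3%:P)]) ->
      extendable_galois_point X /\ galois_group_isom (projection_field X) ('I_2 * 'I_2)%type.
    case=> F10 [B1 [B2 [B3 [[h1 h2 h3] [B10 B20 B30] E]]]].
    have [s0 _ F3] := cubic_Vieta E.
    have [|g1 g2 _] := three_forms_homog h1 h2 h3 B10 B20 B30 s0.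
      by rewrite -[_ * B3]opprK -F3 rpredN homogF.
    exact: (quartic_wild_sufficient fX k2 F10 g1 g2 B10 B20 B30 E).
  have iff : extendable_galois_point X -> (F 1 = 0 /\
      exists B1 B2 B3 : {mpoly k[n.+1]},
        [/\ [/\ B1 \is homog mdeg, B2 \is homog mdeg & B3 \is homog mdeg],
            [/\ B1 != 0, B2 != 0 & B3 != 0]
          & 'X^3 + F 2%N *: 'X + (F 3%N)%:P = ('X - B1%:P) * ('X - B2%:P) * ('X - B3%:P)]).
    move/nec => [F10 [B1 [B2 [B3 [[h1 h2 h3] B0 E]]]]]; split=> //.
    by exists B1, B2, B3; split=> //; split; [exact: homogE h1|exact: homogE h2|exact: homogE h3].
  split; first by split=> [/iff | /suf[]].
  move=> /iff/suf[_ iso]; exists ('I_2 * 'I_2)%type; split=> //.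
  exact: klein_four_dprod.
split; last first.
  move=> ext; exists 'I_4; have [? ?] := cyc 3; split=> //.
  have [E1 E2] := quartic_tame_necessary fX homX k2 hn ext.
  by case: (quartic_tame_sufficient fX (homogF 1 isT) k2 E1 E2).
split; first exact: (quartic_tame_necessary fX homX).
by case=> E1 E2; case: (quartic_tame_sufficient fX (homogF 1 isT) k2 E1 E2).
Qed.
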